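(* Let $(E,\phi)$ be an Anderson $A$-module over $L$ (possibly not abelian) with $A$-motive $\mathcal M=\mathcal M(E)$, and let $\mathrm{Quot}(A\otimes L)$ be the field of fractions of $A\otimes L$. Then: \begin{enumerate} \item $\mathrm{Quot}(A\otimes L)\otimes_{A\otimes L}\mathcal M$ is a finite dimensional $\mathrm{Quot}(A\otimes L)$-vector space. \item There is an element $f\in A\otimes L$ such that, letting $F$ be the multiplicative subset generated by $f$ and all its images under iterated $\tau$-twists, $(A\otimes L)[F^{-1}]\otimes_{A\otimes L}\mathcal M$ is a difference module which is finitely generated as $(A\otimes L)[F^{-1}]$-module. \item The element $f$ and the corresponding set $F$ in (2) can be chosen such that $(A\otimes L)[F^{-1}]\otimes_{A\otimes L}\mathcal M$ is a free $(A\otimes L)[F^{-1}]$-module. \end{enumerate}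
   Context: $\mathbb F_q$ finite field, $C$ smooth projective geometrically irreducible curve over $\mathbb F_q$, $\infty\in C$ closed point, $A=H^0(C\setminus\{\infty\},\mathcal O_C)$, $K=\mathrm{Frac}(A)$, $\mathbb C_\infty$ the completion at a place above $\infty$ of an algebraic closure of $K$. Unlabeled tensors over $\mathbb F_q$. $K\subseteq L\subseteq\mathbb C_\infty$, $\ell:K\to L$ inclusion. Anderson $A$-module $(E,\phi)$ over $L$ of dimension $d$: $E\cong\mathbb G_{a,L}^d$ as $\mathbb F_q$-vector space schemes, $\phi:A\to\mathrm{End}_{\mathbb F_q\text{-v.s.}}(E)$ a ring homomorphism with $d\phi_a-\ell(a)$ nilpotent on $\mathrm{Lie}\,E$ for all $a$. The $\tau$-twist on $A\otimes L$ is $\tau(a\otimes l)=a\otimes l^q$ (it extends to localizations at $\tau$-stable multiplicative subsets). The $A$-motive is $\mathcal M(E)=\mathrm{Hom}_{\mathbb F_q\text{-v.s.}}(E,\mathbb G_{a,L})$, an $A\otimes L$-module with $a\in A$ acting by $m\mapsto m\circ\phi_a$ and $L$ acting by scalar multiplication on $\mathbb G_{a,L}$, together with the $\tau$-semilinear endomorphism $m\mapsto\mathrm{Frob}_q\circ m$ (composition with the $q$-power Frobenius of $\mathbb G_{a,L}$); $E$ is abelian iff $\mathcal M(E)$ is finitely generated over $A\otimes L$. A difference module over a ring with endomorphism $\tau$ is a module with a $\tau$-semilinear endomorphism. *)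

(* Defs.v *)
From HB Require Import structures.
From mathcomp Require Import all_boot all_order all_algebra.
From mathcomp Require Import fraction generic_quotient finfield.
From mathcomp Require pgroup abelian.
From mathcomp Require Import boolp.
From mathcomp Require classical_sets.
From mathcomp Require Import mpoly.
From mathcomp Require Import ring.

Set Implicit Arguments.
Unset Strict Implicit.
Unset Printing Implicit Defensive.

Import Order.TTheory GRing.Theory Num.Theory.
Local Open Scope ring_scope.
Local Open Scope quotient_scope.

Section TensorProduct.
Variables (R : comPzRingType) (M N : lmodType R).

Definition balanced (W : zmodType) (b : M -> N -> W) : Prop :=
  [/\ forall m m' n, b (m + m') n = b m n + b m' n,
      forall m n n', b m (n + n') = b m n + b m n'
    & forall r m n, b (r *: m) n = b m (r *: n)].

Definition fsum_eval (W : zmodType) (b : M -> N -> W) (s : seq (M * N)) : W :=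
  \sum_(x <- s) b x.1 x.2.

(* The congruence generated by the bilinear relations on formal sums of pairs:
   it is the intersection of the kernels of all balanced maps, since the map
   to the quotient by the bilinear relations is itself balanced. *)
Definition tens_eq (s t : seq (M * N)) : bool :=
  `[< forall (W : zmodType) (b : M -> N -> W), balanced b ->
        fsum_eval b s = fsum_eval b t >].

Fact tens_eq_equiv : equiv_class_of tens_eq.
Proof.
split=> [s|s t|t s u].
- exact/asboolP.
- by apply: asbool_equiv_eq; split=> h W b bb; rewrite h.
- by move=> /asboolP st /asboolP tu; apply/asboolP=> W b bb; rewrite st ?tu.
Qed.
Canonical tens_eq_equivRel := EquivRelPack tens_eq_equiv.

Definition tens : Type := {eq_quot tens_eq}.
HB.instance Definition _ := Choice.on tens.
HB.instance Definition _ := EqQuotient.on tens.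

Definition pure (m : M) (n : N) : tens := \pi_tens [:: (m, n)].

Definition tens_lift (W : zmodType) (b : M -> N -> W) (x : tens) : W :=
  fsum_eval b (repr x).

Lemma tens_liftE (W : zmodType) (b : M -> N -> W) s :
  balanced b -> tens_lift b (\pi_tens s) = fsum_eval b s.
Proof.
move=> bb; rewrite /tens_lift; have: repr (\pi_tens s) == s %[mod tens].
  by rewrite reprK.
by rewrite eqmodE => /asboolP ->.
Qed.

Lemma tens_eqP s t :
  (forall (W : zmodType) (b : M -> N -> W), balanced b ->
     fsum_eval b s = fsum_eval b t) -> \pi_tens s = \pi_tens t.
Proof. by move=> h; apply/eqP; rewrite eqmodE; apply/asboolP. Qed.

Lemma fsum_cat (W : zmodType) (b : M -> N -> W) s t :
  fsum_eval b (s ++ t) = fsum_eval b s + fsum_eval b t.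
Proof. by rewrite /fsum_eval big_cat. Qed.

Lemma fsum_opp (W : zmodType) (b : M -> N -> W) s : balanced b ->
  fsum_eval b [seq (- x.1, x.2) | x <- s] = - fsum_eval b s.
Proof.
move=> [bD _ _]; rewrite /fsum_eval big_map -sumrN; apply: eq_bigr => x _ /=.
have b0 n : b 0 n = 0 by apply: (addIr (b 0 n)); rewrite -bD !add0r.
by apply: (addIr (b x.1 x.2)); rewrite -bD !addNr b0.
Qed.

Lemma tens_lift_repr (W : zmodType) (b : M -> N -> W) x :
  tens_lift b x = fsum_eval b (repr x).
Proof. by []. Qed.

Definition tens_zero : tens := \pi_tens [::].
Definition tens_add (x y : tens) : tens := \pi_tens (repr x ++ repr y).
Definition tens_opp (x : tens) : tens :=
  \pi_tens [seq (- z.1, z.2) | z <- repr x].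

Lemma tens_eq_lift (x y : tens) :
  (forall (W : zmodType) (b : M -> N -> W), balanced b ->
     tens_lift b x = tens_lift b y) -> x = y.
Proof. by move=> h; rewrite -[x]reprK -[y]reprK; apply: tens_eqP. Qed.

Let liftD (W : zmodType) (b : M -> N -> W) x y : balanced b ->
  tens_lift b (tens_add x y) = tens_lift b x + tens_lift b y.
Proof. by move=> bb; rewrite tens_liftE // fsum_cat. Qed.

Let liftN (W : zmodType) (b : M -> N -> W) x : balanced b ->
  tens_lift b (tens_opp x) = - tens_lift b x.
Proof. by move=> bb; rewrite tens_liftE // fsum_opp. Qed.

Let lift0 (W : zmodType) (b : M -> N -> W) : balanced b ->
  tens_lift b tens_zero = 0.
Proof. by move=> bb; rewrite tens_liftE // /fsum_eval big_nil. Qed.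

Fact tens_addA : associative tens_add.
Proof. by move=> x y z; apply: tens_eq_lift => W b bb; rewrite !liftD ?addrA. Qed.
Fact tens_addC : commutative tens_add.
Proof. by move=> x y; apply: tens_eq_lift => W b bb; rewrite !liftD // addrC. Qed.
Fact tens_add0 : left_id tens_zero tens_add.
Proof.
by move=> x; apply: tens_eq_lift => W b bb; rewrite liftD ?lift0 ?add0r.
Qed.
Fact tens_addN : left_inverse tens_zero tens_opp tens_add.
Proof.
by move=> x; apply: tens_eq_lift => W b bb; rewrite liftD ?liftN ?lift0 ?addNr.
Qed.
HB.instance Definition _ :=
  GRing.isZmodule.Build tens tens_addA tens_addC tens_add0 tens_addN.

Lemma tens_liftD (W : zmodType) (b : M -> N -> W) : balanced b ->
  {morph tens_lift b : x y / x + y}.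
Proof. by move=> bb x y; exact: liftD. Qed.

Lemma tens_lift0 (W : zmodType) (b : M -> N -> W) : balanced b ->
  tens_lift b 0 = 0.
Proof. exact: lift0. Qed.

Lemma tens_lift_pure (W : zmodType) (b : M -> N -> W) m n :
  balanced b -> tens_lift b (pure m n) = b m n.
Proof. by move=> bb; rewrite tens_liftE // /fsum_eval big_seq1. Qed.

Lemma pure_balanced : balanced pure.
Proof.
by split=> *; apply: tens_eq_lift => W b bb; have [b1 b2 b3] := bb;
   rewrite ?tens_liftD // !tens_lift_pure.
Qed.

Lemma pureDl m m' n : pure (m + m') n = pure m n + pure m' n.
Proof. by have [] := pure_balanced. Qed.
Lemma pureDr m n n' : pure m (n + n') = pure m n + pure m n'.
Proof. by have [] := pure_balanced. Qed.
Lemma pureZ r m n : pure (r *: m) n = pure m (r *: n).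
Proof. by have [] := pure_balanced. Qed.
Lemma pure0l n : pure 0 n = 0.
Proof. by apply: (addIr (pure 0 n)); rewrite -pureDl !add0r. Qed.
Lemma pure0r m : pure m 0 = 0.
Proof. by apply: (addIr (pure m 0)); rewrite -pureDr !add0r. Qed.

Lemma tens_sum_pure (x : tens) : x = \sum_(z <- repr x) pure z.1 z.2.
Proof.
apply: tens_eq_lift => W b bb.
rewrite (big_morph _ (tens_liftD bb) (tens_lift0 bb)) tens_lift_repr.
by apply: eq_bigr => z _; rewrite tens_lift_pure.
Qed.

Lemma tens_ind (P : tens -> Prop) :
  P 0 -> (forall m n, P (pure m n)) -> (forall x y, P x -> P y -> P (x + y)) ->
  forall x, P x.
Proof. by move=> P0 Pp PD x; rewrite [x]tens_sum_pure; apply: big_ind. Qed.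

Lemma tens_additive_ext (W : zmodType) (u v : tens -> W) :
  {morph u : x y / x + y} -> {morph v : x y / x + y} ->
  (forall m n, u (pure m n) = v (pure m n)) -> u =1 v.
Proof.
move=> uD vD uv.
have z0 (h : tens -> W) : {morph h : x y / x + y} -> h 0 = 0.
  by move=> hD; apply: (addIr (h 0)); rewrite -hD !add0r.
by apply: tens_ind => [||x y ux vx]; rewrite ?z0 ?uD ?vD ?ux ?vx.
Qed.

End TensorProduct.

Definition restr (R S : pzRingType) (f : {rmorphism R -> S}) (V : lmodType S)
  : Type := V.

Section Restriction.
Variables (R S : pzRingType) (f : {rmorphism R -> S}) (V : lmodType S).
Local Notation restr := (restr f V).

HB.instance Definition _ := GRing.Zmodule.on restr.

Let restr_scale (r : R) (v : restr) : restr := f r *: (v : V).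
Fact restr_scaleA a b v : restr_scale a (restr_scale b v) = restr_scale (a * b) v.
Proof. by rewrite /restr_scale scalerA rmorphM. Qed.
Fact restr_scale1 : left_id 1 restr_scale.
Proof. by move=> v; rewrite /restr_scale rmorph1 scale1r. Qed.
Fact restr_scaleDr : right_distributive restr_scale +%R.
Proof. by move=> a u v; rewrite /restr_scale scalerDr. Qed.
Fact restr_scaleDl v : {morph restr_scale^~ v : a b / a + b}.
Proof. by move=> a b; rewrite /restr_scale rmorphD scalerDl. Qed.
HB.instance Definition _ := GRing.Zmodule_isLmodule.Build R restr
  restr_scaleA restr_scale1 restr_scaleDr restr_scaleDl.

Lemma restrE r (v : V) : r *: (v : restr) = (f r *: v) :> V.
Proof. by []. Qed.

End Restriction.

Section BaseChange.
Variables (R B : comPzRingType) (f : {rmorphism R -> B}) (N : lmodType R).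

Definition baseChange : Type := tens (restr f B^o) N.
HB.instance Definition _ := GRing.Zmodule.on baseChange.

Definition bpure (b : B) (n : N) : baseChange := pure (b : restr f B^o) n.

Let act (c : B) (b : restr f B^o) (n : N) : baseChange := bpure (c * (b : B)) n.

Let act_bal c : balanced (act c).
Proof.
split=> [m m' n|m n n'|r m n]; rewrite /act /bpure.
- by rewrite -pureDl; congr pure; apply: mulrDr.
- by rewrite pureDr.
- rewrite -pureZ; congr pure.
  by rewrite !restrE /GRing.scale /= mulrCA.
Qed.

Definition bc_scale (c : B) (x : baseChange) : baseChange := tens_lift (act c) x.

Lemma bc_scale_pure c b n : bc_scale c (bpure b n) = bpure (c * b) n.
Proof. by rewrite /bc_scale (tens_lift_pure _ _ (act_bal c)). Qed.

Let scD c : {morph bc_scale c : x y / x + y}.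
Proof. exact: (tens_liftD (act_bal c)). Qed.

Fact bc_scaleA a b v : bc_scale a (bc_scale b v) = bc_scale (a * b) v.
Proof.
move: v; apply: tens_additive_ext => [x y|x y|m n]; rewrite ?scD //.
by rewrite !bc_scale_pure mulrA.
Qed.
Fact bc_scale1 : left_id 1 bc_scale.
Proof.
apply: tens_additive_ext => [x y|x y|m n]; rewrite ?scD //.
by rewrite bc_scale_pure mul1r.
Qed.
Fact bc_scaleDr : right_distributive bc_scale +%R.
Proof. by move=> c x y; rewrite scD. Qed.
Fact bc_scaleDl v : {morph bc_scale^~ v : a b / a + b}.
Proof.
move=> a b; move: v; apply: tens_additive_ext => [x y|x y|m n].
- by rewrite scD.
- by rewrite !scD addrACA.
- by rewrite !bc_scale_pure mulrDl /bpure -pureDl.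
Qed.
HB.instance Definition _ := GRing.Zmodule_isLmodule.Build B baseChange
  bc_scaleA bc_scale1 bc_scaleDr bc_scaleDl.

Lemma bpureZ c b n : c *: bpure b n = bpure (c * b) n.
Proof. exact: bc_scale_pure. Qed.

End BaseChange.

Section AlgebraTensor.
Variables (R B C : comPzRingType).
Variables (f : {rmorphism R -> B}) (g : {rmorphism R -> C}).

Definition algTens : Type := tens (restr f B^o) (restr g C^o).
HB.instance Definition _ := GRing.Zmodule.on algTens.

Definition apure (b : B) (c : C) : algTens :=
  pure (b : restr f B^o) (c : restr g C^o).

Lemma apureDl b b' c : apure (b + b') c = apure b c + apure b' c.
Proof. exact: pureDl. Qed.
Lemma apureDr b c c' : apure b (c + c') = apure b c + apure b c'.
Proof. exact: pureDr. Qed.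
Lemma apureZ r b c : apure (f r * b) c = apure b (g r * c).
Proof. exact: (pureZ r (b : restr f B^o) (c : restr g C^o)). Qed.

Lemma algTens_ind (P : algTens -> Prop) :
  P 0 -> (forall b c, P (apure b c)) -> (forall x y, P x -> P y -> P (x + y)) ->
  forall x, P x.
Proof. by move=> P0 Pp PD; apply: tens_ind. Qed.

Lemma algTens_ext (W : zmodType) (u v : algTens -> W) :
  {morph u : x y / x + y} -> {morph v : x y / x + y} ->
  (forall b c, u (apure b c) = v (apure b c)) -> u =1 v.
Proof. by move=> uD vD uv; apply: tens_additive_ext. Qed.

Let mul1 (b : B) (c : C) (b' : restr f B^o) (c' : restr g C^o) : algTens :=
  apure (b * (b' : B)) (c * (c' : C)).

Let mul1_bal b c : balanced (mul1 b c).
Proof.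
split=> [m m' n|m n n'|r m n]; rewrite /mul1.
- by rewrite -apureDl; congr apure; apply: mulrDr.
- by rewrite -apureDr; congr apure; apply: mulrDr.
- by rewrite !restrE /GRing.scale /= [b * (_ * _)]mulrCA [c * (_ * _)]mulrCA apureZ.
Qed.

Let mul2 (y : algTens) (b : restr f B^o) (c : restr g C^o) : algTens :=
  tens_lift (mul1 b c) y.

Let mul2_pure b' c' b c : mul2 (apure b' c') b c = apure (b * b') (c * c').
Proof. by rewrite /mul2 (tens_lift_pure _ _ (mul1_bal b c)). Qed.

Let mul2D b c : {morph (fun y => mul2 y b c) : x y / x + y}.
Proof. exact: (tens_liftD (mul1_bal b c)). Qed.

Let mul2_bal y : balanced (mul2 y).
Proof.
rewrite /mul2 /tens_lift /fsum_eval.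
split=> [m m' n|m n n'|r m n]; rewrite -?big_split /=;
  apply: eq_bigr => -[b c] _; rewrite /mul1 /=.
- by rewrite -apureDl; congr apure; apply: mulrDl.
- by rewrite -apureDr; congr apure; apply: mulrDl.
- by rewrite !restrE /GRing.scale /= -!mulrA apureZ.
Qed.

Definition at_mul (x y : algTens) : algTens := tens_lift (mul2 y) x.

Lemma at_mul_pure b c b' c' :
  at_mul (apure b c) (apure b' c') = apure (b * b') (c * c').
Proof. by rewrite /at_mul (tens_lift_pure _ _ (mul2_bal _)) mul2_pure. Qed.

Fact at_mulDl : left_distributive at_mul +%R.
Proof. by move=> x y z; exact: (tens_liftD (mul2_bal z)). Qed.

Let at_mulDr x y z : at_mul x (y + z) = at_mul x y + at_mul x z.
Proof.
rewrite /at_mul /tens_lift /fsum_eval -big_split /=.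
by apply: eq_bigr => -[b c] _; apply: mul2D.
Qed.

Fact at_mulC : commutative at_mul.
Proof.
move=> x y.
apply: (algTens_ext (u := at_mul^~ y) (v := at_mul y)) => [u v|u v|b c] /=.
- exact: at_mulDl.
- exact: at_mulDr.
apply: (algTens_ext (u := at_mul (apure b c)) (v := at_mul^~ (apure b c)))
  => [u v|u v|b' c'] /=.
- exact: at_mulDr.
- exact: at_mulDl.
by rewrite !at_mul_pure mulrC [c * _]mulrC.
Qed.

Fact at_mulA : associative at_mul.
Proof.
move=> x y z.
apply: (algTens_ext (u := fun x => at_mul x (at_mul y z))
                    (v := fun x => at_mul (at_mul x y) z)) => [u v|u v|b c] /=.
- exact: at_mulDl.
- by rewrite !at_mulDl.
apply: (algTens_ext (u := fun y => at_mul (apure b c) (at_mul y z))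
                    (v := fun y => at_mul (at_mul (apure b c) y) z))
  => [u v|u v|b' c'] /=.
- by rewrite at_mulDl at_mulDr.
- by rewrite at_mulDr at_mulDl.
apply: (algTens_ext (u := fun z => at_mul (apure b c) (at_mul (apure b' c') z))
                    (v := fun z => at_mul (at_mul (apure b c) (apure b' c')) z))
  => [u v|u v|b2 c2] /=.
- by rewrite !at_mulDr.
- by rewrite at_mulDr.
by rewrite !at_mul_pure !mulrA.
Qed.

Fact at_mul1 : left_id (apure 1 1) at_mul.
Proof.
apply: (algTens_ext (u := at_mul (apure 1 1)) (v := id)) => [u v|u v|b c] /=.
- exact: at_mulDr.
- by [].
- by rewrite at_mul_pure !mul1r.
Qed.

HB.instance Definition _ := GRing.Zmodule_isComPzRing.Build algTens
  at_mulA at_mulC at_mul1 at_mulDl.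

Lemma apureM b c b' c' : apure b c * apure b' c' = apure (b * b') (c * c').
Proof. exact: at_mul_pure. Qed.
Lemma apure1 : apure 1 1 = 1.
Proof. by []. Qed.
Lemma apureX b c n : apure b c ^+ n = apure (b ^+ n) (c ^+ n).
Proof. by elim: n => [|n IH]; rewrite ?expr0 // !exprS IH apureM. Qed.

End AlgebraTensor.

Section AlgebraTensorMap.
Variables (R B C B' C' : comPzRingType).
Variables (f : {rmorphism R -> B}) (g : {rmorphism R -> C}).
Variables (f' : {rmorphism R -> B'}) (g' : {rmorphism R -> C'}).
Variables (u : {rmorphism B -> B'}) (v : {rmorphism C -> C'}).

Let map1 (b : restr f B^o) (c : restr g C^o) : algTens f' g' :=
  apure f' g' (u b) (v c).

Definition algTens_map (x : algTens f g) : algTens f' g' := tens_lift map1 x.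

Hypotheses (uf : forall r, u (f r) = f' r) (vg : forall r, v (g r) = g' r).

Let map1_bal : balanced map1.
Proof.
split=> [m m' n|m n n'|r m n]; rewrite /map1.
- by rewrite -apureDl -rmorphD.
- by rewrite -apureDr -rmorphD.
- by rewrite !restrE /GRing.scale /= !rmorphM /= uf vg apureZ.
Qed.

Lemma algTens_map_pure b c :
  algTens_map (apure f g b c) = apure f' g' (u b) (v c).
Proof. by rewrite /algTens_map (tens_lift_pure _ _ map1_bal). Qed.

Lemma algTens_mapD : {morph algTens_map : x y / x + y}.
Proof. exact: (tens_liftD map1_bal). Qed.

Lemma algTens_map0 : algTens_map 0 = 0.
Proof. exact: (tens_lift0 map1_bal). Qed.

Lemma algTens_mapB : {morph algTens_map : x y / x - y}.
Proof.
move=> x y; apply: (addIr (algTens_map y)).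
by rewrite -algTens_mapD !subrK.
Qed.

Lemma algTens_map_monoid : monoid_morphism algTens_map.
Proof.
split=> [|x y]; first by rewrite -!apure1 algTens_map_pure !rmorph1.
apply: (algTens_ext (u := fun x => algTens_map (x * y))
          (v := fun x => algTens_map x * algTens_map y)) => [a b|a b|b c] /=.
- by rewrite mulrDl algTens_mapD.
- by rewrite algTens_mapD mulrDl.
apply: (algTens_ext (u := fun y => algTens_map (apure f g b c * y))
          (v := fun y => algTens_map (apure f g b c) * algTens_map y))
  => [a a'|a a'|b' c'] /=.
- by rewrite mulrDr algTens_mapD.
- by rewrite algTens_mapD mulrDr.
by rewrite apureM !algTens_map_pure apureM !rmorphM.
Qed.

End AlgebraTensorMap.

Lemma separating_functional (F : fieldType) (N : lmodType F) (U : N -> Prop)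
    (v : N) :
  U 0 -> (forall a x y, U x -> U y -> U (a *: x + y)) -> ~ U v ->
  exists lam : N -> F, [/\ forall x y, lam (x + y) = lam x + lam y,
    forall a x, lam (a *: x) = a * lam x, lam v = 1 & forall x, U x -> lam x = 0].
Proof.
move=> U0 UL Uv.
pose lin (A : N -> Prop) := forall a x y, A x -> A y -> A (a *: x + y).
pose P (A : N -> Prop) :=
  [/\ ((exists x, A x) -> forall x, U x -> A x), lin A & ~ A v].
have [|A [[UA linA Av] maxA]] := @classical_sets.Zorn_bigcup N P.
  move=> C CP tot; split.
  - move=> [x [B CB Bx]] y Uy; exists B => //; have [UB _ _] := CP _ CB.
    by apply: UB => //; exists x.
  - move=> a x y [B CB Bx] [D CD Dy].
    have [BD|DB] := tot _ _ CB CD.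
    + by exists D => //; have [_ l _] := CP _ CD; apply: l => //; apply: BD.
    + by exists B => //; have [_ l _] := CP _ CB; apply: l => //; apply: DB.
  - by move=> [B CB Bv]; have [_ _] := CP _ CB; apply.
have {}UA x : U x -> A x.
  apply: UA; apply: contrapT => Ae; apply: (maxA U) => //.
  split=> [y Ay|UA]; first by case: Ae; exists y.
  by apply: Ae; exists 0; apply: UA.
have A0 := UA _ U0.
have AZ a x : A x -> A (a *: x) by move=> Ax; rewrite -[_ *: _]addr0; apply: linA.
have AD x y : A x -> A y -> A (x + y).
  by move=> Ax Ay; rewrite -[x]scale1r; apply: linA.
have AN x : A x -> A (- x) by rewrite -scaleN1r; apply: AZ.
have dec x : exists c, A (x - c *: v).
  apply: contrapT => nx; pose B y := exists c a, A a /\ y = a + c *: x.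
  have Ax : ~ A x by move=> Ax; apply: nx; exists 0; rewrite scale0r subr0.
  apply: (maxA B).
    split=> [y Ay|BA]; first by exists 0, y; rewrite scale0r addr0.
    by apply: Ax; apply: BA; exists 1, 0; rewrite scale1r add0r.
  split=> [_ y Uy|a y z [c [b [Ab ->]]] [d [e [Ae ->]]]|].
  - by exists 0, y; rewrite scale0r addr0; split=> //; apply: UA.
  - exists (a * c + d), (a *: b + e); split; first exact: linA.
    by rewrite scalerDr scalerDl scalerA addrACA.
  - move=> [c [a [Aa va]]]; have c0 : c != 0.
      by apply: contra_notN Av => /eqP c0; rewrite va c0 scale0r addr0.
    apply: nx; exists c^-1; rewrite va scalerDr scalerA mulVf // scale1r.
    by rewrite opprD addrCA subrr addr0; apply: AN; apply: AZ.
have uniq x c d : A (x - c *: v) -> A (x - d *: v) -> c = d.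
  move=> h k; apply: contrapT => cd; have cd0 : d - c != 0.
    by rewrite subr_eq0 eq_sym; apply/eqP.
  apply: Av; rewrite -[v]scale1r -(mulVf cd0) -scalerA; apply: AZ.
  have := AD _ _ h (AN _ k); rewrite opprB addrC addrA subrK.
  by rewrite scalerBl.
pose lam x := sval (cid (dec x)).
have lamP x : A (x - lam x *: v) := svalP (cid (dec x)).
exists lam; split=> [x y|a x||x Ux].
- apply: uniq (lamP _) _; rewrite scalerDl opprD addrACA.
  by apply: AD; apply: lamP.
- apply: uniq (lamP _) _; rewrite -scalerA -scalerBr.
  by apply: AZ; apply: lamP.
- by apply: uniq (lamP _) _; rewrite scale1r subrr.
- by apply: uniq (lamP _) _; rewrite scale0r subr0; apply: UA.
Qed.

Definition indep (F : fieldType) (N : lmodType F) k (n : 'I_k -> N) : Prop :=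
  forall c : 'I_k -> F, \sum_i c i *: n i = 0 -> forall i, c i = 0.

Lemma tens_indep (F : fieldType) (M N : lmodType F) k (m : 'I_k -> M)
    (n : 'I_k -> N) :
  indep n -> \sum_i pure (m i) (n i) = 0 -> forall i, m i = 0.
Proof.
move=> nI s0 i.
pose U x := exists2 c : 'I_k -> F, c i = 0 & x = \sum_j c j *: n j.
have [| |c0|lam [lamD lamZ lam1 lamU]] := @separating_functional F N U (n i).
- by exists (fun=> 0) => //; rewrite big1 // => j _; rewrite scale0r.
- move=> a x y [c ci ->] [d di ->]; exists (fun j => a * c j + d j).
    by rewrite ci di mulr0 addr0.
  rewrite scaler_sumr -big_split; apply: eq_bigr => j _ /=.
  by rewrite scalerDl scalerA.
- case: c0 => c ci ni; have := nI (fun j => c j - (j == i)%:R).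
  move=> /(_ _ i); rewrite ci eqxx sub0r => h.
  have /eqP : - (1 : F) = 0.
    apply: h; under eq_bigr do rewrite scalerBl.
    rewrite sumrB -ni (bigD1 i) //= eqxx scale1r big1 ?addr0 ?subrr //.
    by move=> j /negPf->; rewrite scale0r.
  by rewrite oppr_eq0 oner_eq0.
pose b (x : M) (y : N) : M := lam y *: x.
have bb : balanced b.
  split=> [x x' y|x y y'|r x y]; rewrite /b ?scalerDr ?lamD ?scalerDl //.
  by rewrite lamZ scalerA mulrC.
have := congr1 (tens_lift b) s0.
rewrite (tens_lift0 bb) (big_morph _ (tens_liftD bb) (tens_lift0 bb)).
under eq_bigr do rewrite (tens_lift_pure _ _ bb).
rewrite (bigD1 i) //= {1}/b lam1 scale1r big1 ?addr0 // => j ji.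
rewrite /b lamU ?scale0r //; exists (fun l => (l == j)%:R).
  by rewrite eq_sym (negPf ji).
rewrite (bigD1 j) //= eqxx scale1r big1 ?addr0 // => l /negPf->.
by rewrite scale0r.
Qed.

Lemma tens_indep_form (F : fieldType) (M N : lmodType F) (x : tens M N) :
  exists k (m : 'I_k -> M) (n : 'I_k -> N),
    indep n /\ x = \sum_i pure (m i) (n i).
Proof.
pose R k := exists (m : 'I_k -> M) (n : 'I_k -> N), x = \sum_i pure (m i) (n i).
have ex : exists k, `[< R k >].
  exists (size (repr x)); apply/asboolP.
  exists (fun i => (tnth (in_tuple (repr x)) i).1).
  exists (fun i => (tnth (in_tuple (repr x)) i).2).
  by rewrite {1}[x]tens_sum_pure big_tnth.
case: (ex_minnP ex) => k /asboolP [m [n xE]] kmin; exists k, m, n; split=> //.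
move=> c cn j; apply: contrapT => /eqP cj.
case: k m n c j xE cn cj kmin => [|k] m n c j xE cn cj kmin; first by case: j cj.
suff : (k.+1 <= k)%N by rewrite ltnn.
apply: kmin; apply/asboolP.
exists (fun i => m (lift j i) - (c (lift j i) / c j) *: m j).
exists (fun i => n (lift j i)).
have nj : n j = - \sum_i (c (lift j i) / c j) *: n (lift j i).
  move: cn; rewrite (bigD1_ord j) //= => /eqP; rewrite addr_eq0 => /eqP cn.
  rewrite -[n j]scale1r -(mulVf cj) -scalerA cn scalerN scaler_sumr.
  by congr (- _); apply: eq_bigr => i _; rewrite scalerA mulrC.
rewrite xE (bigD1_ord j) //= nj.
have pN (y : M) (z : N) : pure y (- z) = pure (- y) z.
  by rewrite -[- z]scaleN1r -pureZ scaleN1r.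
rewrite pN (big_morph (pure (- m j)) (pureDr _) (pure0r _ _)) -big_split /=.
apply: eq_bigr => i _; rewrite -pureZ -pureDl; congr pure.
by rewrite scalerN addrC.
Qed.

Lemma exprD_prime (R : comPzRingType) p (x y : R) : prime p -> p%:R = 0 :> R ->
  (x + y) ^+ p = x ^+ p + y ^+ p.
Proof.
case: p => // p pp p0; rewrite exprDn big_ord_recl big_ord_recr /=.
rewrite subn0 subnn bin0 binn !expr0 mulr1 mul1r !mulr1n.
rewrite big1 ?add0r // => i _.
have /dvdnP[k ->] : (p.+1 %| 'C(p.+1, bump 0 i))%N.
  by rewrite prime_dvd_bin // /bump leq0n add1n /= ltnS ltn_ord.
by rewrite mulrnA -mulr_natr p0 mulr0.
Qed.

Lemma exprD_pow (R : comPzRingType) p e (x y : R) : prime p -> p%:R = 0 :> R ->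
  (x + y) ^+ (p ^ e) = x ^+ (p ^ e) + y ^+ (p ^ e).
Proof.
move=> pp p0; elim: e => [|e IH]; first by rewrite !expr1.
by rewrite expnSr !exprM IH exprD_prime.
Qed.

Lemma card_fin_field (F : finFieldType) :
  exists p e, [/\ prime p, p \in [pchar F] & #|F| = (p ^ e)%N].
Proof.
have [p pp pF] := finPcharP F; exists p.
have /abelian.abelem_pgroup := abelian.fin_ring_pchar_abelem pF.
by rewrite /pgroup.pgroup cardsT => /p_natP[e qE]; exists e.
Qed.

Section Frobenius.
Variables (F : finFieldType) (R : comPzRingType).

Lemma exprD_card (e : nat) (x y : R) : (forall p, p \in [pchar F] -> p%:R = 0 :> R) ->
  (x + y) ^+ (#|F| ^ e) = x ^+ (#|F| ^ e) + y ^+ (#|F| ^ e).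
Proof.
move=> R0; have [p [k [pp pF ->]]] := card_fin_field F.
by rewrite -expnM exprD_pow ?R0.
Qed.

Lemma rmorph_pchar0 (g : {rmorphism F -> R}) p : p \in [pchar F] -> p%:R = 0 :> R.
Proof. by move=> pF; rewrite -(rmorph_nat g) (pcharf0 pF) rmorph0. Qed.

End Frobenius.

Lemma card_gt0F (F : finFieldType) : (0 < #|F|)%N.
Proof. by apply/card_gt0P; exists 0. Qed.

Definition frob (F : finFieldType) (R : comPzRingType)
  (g : {rmorphism F -> R}) (x : R) : R := x ^+ #|F|.

Section FrobeniusMorphism.
Variables (F : finFieldType) (R : comPzRingType) (g : {rmorphism F -> R}).

Fact frob_additive : nmod_morphism (frob g).
Proof.
split=> [|x y]; first by rewrite /frob expr0n (gtn_eqF (card_gt0F F)).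
by have := exprD_card 1 x y (rmorph_pchar0 g); rewrite expn1.
Qed.
Fact frob_monoid : monoid_morphism (frob g).
Proof. by split=> [|x y]; rewrite /frob ?expr1n ?exprMn. Qed.
HB.instance Definition _ := GRing.isNmodMorphism.Build R R (frob g) frob_additive.
HB.instance Definition _ := GRing.isMonoidMorphism.Build R R (frob g) frob_monoid.

Lemma frob_base c : frob g (g c) = g c.
Proof. by rewrite /frob -rmorphXn expf_card. Qed.

End FrobeniusMorphism.

Section Reduced.
Variables (F : finFieldType) (A : comPzRingType) (K L : fieldType).
Variables (f : {rmorphism F -> A}) (h : {rmorphism A -> K}).
Variables (i : {rmorphism F -> K}) (g : {rmorphism F -> L}).
Hypotheses (hf : forall c, h (f c) = i c) (h_inj : injective h).

Lemma apure_natl n : (n%:R : algTens i g) = apure i g n%:R 1.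
Proof.
elim: n => [|n IH]; first by rewrite /apure pure0l.
by rewrite -!natr1 IH apureDl.
Qed.

Lemma algTens_pchar0 p : p \in [pchar F] -> p%:R = 0 :> algTens i g.
Proof.
by move=> pF; rewrite apure_natl (rmorph_pchar0 i pF) /apure pure0l.
Qed.

Lemma algTens_nilp_eq0 (x : algTens f g) n :
  algTens_map i g h idfun x ^+ n = 0 -> x = 0.
Proof.
have [k [a [l [lI xE]]]] := tens_indep_form x.
set X := algTens_map _ _ _ _ x => Xn.
have mD := @algTens_mapD _ _ _ _ _ _ g _ g h idfun hf (fun=> erefl).
have m0 := @algTens_map0 _ _ _ _ _ _ g _ g h idfun hf (fun=> erefl).
have mp := @algTens_map_pure _ _ _ _ _ _ g _ g h idfun hf (fun=> erefl).
have XE : X = \sum_j apure i g (h (a j)) (l j).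
  rewrite /X xE (big_morph _ mD m0); apply: eq_bigr => j _; exact: mp.
have qn : (n <= #|F| ^ n)%N by apply/ltnW/ltn_expl/finNzRing_gt1.
set N := (#|F| ^ n)%N in qn.
have XN : X ^+ N = 0 by rewrite -(subnK qn) exprD Xn mulr0.
have N0 : N != 0%N by rewrite -lt0n expn_gt0 card_gt0F.
have XNE : X ^+ N = \sum_j apure i g (h (a j) ^+ N) (l j ^+ N).
  rewrite XE (big_morph (fun y => y ^+ N) (id1 := 0) (op1 := +%R)).
  - by apply: eq_bigr => j _; rewrite apureX.
  - by move=> y z; apply: exprD_card; apply: algTens_pchar0.
  - by rewrite expr0n (negPf N0).
have lN : indep (fun j => (l j ^+ N : restr g L^o)).
  move=> c sc; apply: lI.
  have gN d : g d = g d ^+ N.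
    by rewrite /N; elim: (n) => [|e IH]; rewrite ?expr1 // expnS exprM -rmorphXn expf_card.
  suff : (\sum_j g (c j) * l j) ^+ N = 0 :> L.
    by move=> /eqP; rewrite expf_eq0 => /andP[_ /eqP].
  rewrite (big_morph (fun y => y ^+ N) (id1 := 0) (op1 := +%R)).
  - rewrite -[RHS]sc; apply: eq_bigr => j _.
    by rewrite restrE exprMn -gN.
  - by move=> y z; apply: exprD_card; apply: rmorph_pchar0.
  - by rewrite expr0n (negPf N0).
have aN j : h (a j) ^+ N = 0.
  apply: (tens_indep (m := fun j => (h (a j) ^+ N : restr i K^o)) lN).
  by rewrite -[RHS]XN XNE.
rewrite xE big1 // => j _.
have -> : a j = 0; last exact: pure0l.
by apply: h_inj; rewrite rmorph0; have /eqP := aN j; rewrite expf_eq0 => /andP[_ /eqP].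
Qed.

End Reduced.

Section Localization.
Variables (T : comPzRingType) (S : mulrClosed T).

Local Notation den := {s : T | s \in S}.

Definition loc_eq (x y : T * den) : bool :=
  `[< exists2 u, u \in S & u * (x.1 * val y.2) = u * (y.1 * val x.2) >].

Fact loc_eq_equiv : equiv_class_of loc_eq.
Proof.
split=> [x|x y|y x z].
- by apply/asboolP; exists 1; rewrite ?rpred1.
- by apply: asbool_equiv_eq; split=> -[u uS e]; exists u.
- move=> /asboolP[u uS e] /asboolP[v vS e']; apply/asboolP.
  exists (val y.2 * (u * v)); first by rewrite !rpredM // (valP y.2).
  have -> : val y.2 * (u * v) * (x.1 * val z.2) =
            v * val z.2 * (u * (x.1 * val y.2)) by ring.
  rewrite e.
  have -> : v * val z.2 * (u * (y.1 * val x.2)) =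
            u * val x.2 * (v * (y.1 * val z.2)) by ring.
  by rewrite e'; ring.
Qed.
Canonical loc_eq_equivRel := EquivRelPack loc_eq_equiv.

Definition loc : Type := {eq_quot loc_eq}.
HB.instance Definition _ := Choice.on loc.
HB.instance Definition _ := EqQuotient.on loc.

Definition den1 : den := exist _ 1 (rpred1 S).
Definition denM (s t : den) : den :=
  exist _ (val s * val t) (rpredM (valP s) (valP t)).

Definition locfrac (t : T) (s : den) : loc := \pi_loc (t, s).

Lemma locfrac_eq t s t' s' : locfrac t s = locfrac t' s' <->
  exists2 u, u \in S & u * (t * val s') = u * (t' * val s).
Proof.
split=> [/eqP|h]; first by rewrite /locfrac eqmodE => /asboolP.
by apply/eqP; rewrite /locfrac eqmodE; apply/asboolP.
Qed.

Lemma locfrac_eq1 t s t' s' : t * val s' = t' * val s ->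
  locfrac t s = locfrac t' s'.
Proof. by move=> e; apply/locfrac_eq; exists 1; rewrite ?rpred1 ?e. Qed.

Lemma locfracP (x : loc) : exists t s, x = locfrac t s.
Proof. by exists (repr x).1, (repr x).2; rewrite /locfrac -surjective_pairing reprK. Qed.

Definition loc_add (x y : loc) : loc :=
  locfrac ((repr x).1 * val (repr y).2 + (repr y).1 * val (repr x).2)
          (denM (repr x).2 (repr y).2).
Definition loc_opp (x : loc) : loc := locfrac (- (repr x).1) (repr x).2.
Definition loc_mul (x y : loc) : loc :=
  locfrac ((repr x).1 * (repr y).1) (denM (repr x).2 (repr y).2).

Let reprP t s : exists2 u, u \in S &
  u * ((repr (locfrac t s)).1 * val s) = u * (t * val (repr (locfrac t s)).2).
Proof. by apply/locfrac_eq; rewrite /locfrac -surjective_pairing reprK. Qed.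

Lemma loc_addE t s t' s' : loc_add (locfrac t s) (locfrac t' s') =
  locfrac (t * val s' + t' * val s) (denM s s').
Proof.
have [u uS e] := reprP t s; have [v vS e'] := reprP t' s'.
apply/locfrac_eq; exists (u * v); first exact: rpredM.
case: (repr _) e => [a b] /= e; case: (repr _) e' => [c d] /= e'.
transitivity (v * (val d * val s') * (u * (a * val s))
            + u * (val b * val s) * (v * (c * val s'))); first by move=> /=; ring.
by rewrite e e' /=; ring.
Qed.

Lemma loc_oppE t s : loc_opp (locfrac t s) = locfrac (- t) s.
Proof.
have [u uS e] := reprP t s; apply/locfrac_eq; exists u => //.
by rewrite !mulNr !mulrN e.
Qed.

Lemma loc_mulE t s t' s' : loc_mul (locfrac t s) (locfrac t' s') =
  locfrac (t * t') (denM s s').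
Proof.
have [u uS e] := reprP t s; have [v vS e'] := reprP t' s'.
apply/locfrac_eq; exists (u * v); first exact: rpredM.
case: (repr _) e => [a b] /= e; case: (repr _) e' => [c d] /= e'.
transitivity (u * (a * val s) * (v * (c * val s'))); first by move=> /=; ring.
by rewrite e e' /=; ring.
Qed.

Fact loc_addA : associative loc_add.
Proof.
move=> x y z; have [a [p ->]] := locfracP x; have [b [q ->]] := locfracP y.
have [c [r ->]] := locfracP z; rewrite !loc_addE; apply: locfrac_eq1 => /=; ring.
Qed.
Fact loc_addC : commutative loc_add.
Proof.
move=> x y; have [a [p ->]] := locfracP x; have [b [q ->]] := locfracP y.
by rewrite !loc_addE; apply: locfrac_eq1 => /=; ring.
Qed.
Fact loc_add0 : left_id (locfrac 0 den1) loc_add.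
Proof.
move=> x; have [a [p ->]] := locfracP x.
by rewrite !loc_addE; apply: locfrac_eq1 => /=; ring.
Qed.
Fact loc_addN : left_inverse (locfrac 0 den1) loc_opp loc_add.
Proof.
move=> x; have [a [p ->]] := locfracP x.
by rewrite loc_oppE !loc_addE; apply: locfrac_eq1 => /=; ring.
Qed.
HB.instance Definition _ :=
  GRing.isZmodule.Build loc loc_addA loc_addC loc_add0 loc_addN.

Fact loc_mulA : associative loc_mul.
Proof.
move=> x y z; have [a [p ->]] := locfracP x; have [b [q ->]] := locfracP y.
have [c [r ->]] := locfracP z; rewrite !loc_mulE; apply: locfrac_eq1 => /=; ring.
Qed.
Fact loc_mulC : commutative loc_mul.
Proof.
move=> x y; have [a [p ->]] := locfracP x; have [b [q ->]] := locfracP y.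
by rewrite !loc_mulE; apply: locfrac_eq1 => /=; ring.
Qed.
Fact loc_mul1 : left_id (locfrac 1 den1) loc_mul.
Proof.
move=> x; have [a [p ->]] := locfracP x.
by rewrite !loc_mulE; apply: locfrac_eq1 => /=; ring.
Qed.
Fact loc_mulDl : left_distributive loc_mul +%R.
Proof.
move=> x y z; have [a [p ->]] := locfracP x; have [b [q ->]] := locfracP y.
have [c [r ->]] := locfracP z.
have addE u v : u + v = loc_add u v by [].
rewrite !addE [loc_add (locfrac a p) _]loc_addE !loc_mulE loc_addE.
by apply: locfrac_eq1 => /=; ring.
Qed.
HB.instance Definition _ := GRing.Zmodule_isComPzRing.Build loc
  loc_mulA loc_mulC loc_mul1 loc_mulDl.

Lemma locfracD t s t' s' : locfrac t s + locfrac t' s' =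
  locfrac (t * val s' + t' * val s) (denM s s').
Proof. exact: loc_addE. Qed.
Lemma locfracM t s t' s' : locfrac t s * locfrac t' s' =
  locfrac (t * t') (denM s s').
Proof. exact: loc_mulE. Qed.

Definition toloc (t : T) : loc := locfrac t den1.

Fact toloc_additive : nmod_morphism toloc.
Proof.
split=> // x y; rewrite /toloc locfracD; apply: locfrac_eq1 => /=; ring.
Qed.
Fact toloc_monoid : monoid_morphism toloc.
Proof.
split=> // x y; rewrite /toloc locfracM; apply: locfrac_eq1 => /=; ring.
Qed.
HB.instance Definition _ := GRing.isNmodMorphism.Build T loc toloc toloc_additive.
HB.instance Definition _ := GRing.isMonoidMorphism.Build T loc toloc toloc_monoid.

End Localization.

Section LocalizationMap.
Variables (T : comPzRingType) (tau : {rmorphism T -> T}) (S : mulrClosed T).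
Hypothesis tauS : forall s, s \in S -> tau s \in S.

Definition loc_map (x : loc S) : loc S :=
  locfrac (tau (repr x).1) (exist _ (tau (val (repr x).2)) (tauS (valP (repr x).2))).

Lemma loc_mapE t s :
  loc_map (locfrac t s) = locfrac (tau t) (exist _ (tau (val s)) (tauS (valP s))).
Proof.
have /locfrac_eq[u uS e] :
    locfrac (repr (locfrac t s)).1 (repr (locfrac t s)).2 = locfrac t s.
  by rewrite /locfrac -surjective_pairing reprK.
apply/locfrac_eq; exists (tau u); first exact: tauS.
by rewrite /= -!rmorphM e.
Qed.

Fact loc_map_additive : nmod_morphism loc_map.
Proof.
split=> [|x y].
  by rewrite -[0]/(locfrac 0 (den1 S)) loc_mapE; apply: locfrac_eq1;
     rewrite rmorph0 !mul0r.
have [a [p ->]] := locfracP x; have [b [q ->]] := locfracP y.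
rewrite locfracD !loc_mapE locfracD; apply: locfrac_eq1 => /=.
by rewrite rmorphD !rmorphM.
Qed.
Fact loc_map_monoid : monoid_morphism loc_map.
Proof.
split=> [|x y].
  by rewrite -[1]/(locfrac 1 (den1 S)) loc_mapE; apply: locfrac_eq1;
     rewrite /= rmorph1.
have [a [p ->]] := locfracP x; have [b [q ->]] := locfracP y.
rewrite locfracM !loc_mapE locfracM; apply: locfrac_eq1 => /=.
by rewrite !rmorphM.
Qed.
HB.instance Definition _ :=
  GRing.isNmodMorphism.Build (loc S) (loc S) loc_map loc_map_additive.
HB.instance Definition _ :=
  GRing.isMonoidMorphism.Build (loc S) (loc S) loc_map loc_map_monoid.

End LocalizationMap.

Section Twists.
Variables (T : comPzRingType) (tau : {rmorphism T -> T}) (f : T).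

Definition twists : {pred T} :=
  fun x => `[< exists e : seq nat, x = \prod_(n <- e) iter n tau f >].

Fact twists_mulr_closed : GRing.mulr_closed twists.
Proof.
split=> [|x y /asboolP[e ->] /asboolP[e' ->]]; apply/asboolP.
  by exists [::]; rewrite big_nil.
by exists (e ++ e'); rewrite big_cat.
Qed.
HB.instance Definition _ := GRing.isMulClosed.Build T twists twists_mulr_closed.

Lemma twists_stable x : x \in twists -> tau x \in twists.
Proof.
move=> /asboolP[e ->]; apply/asboolP; exists [seq n.+1 | n <- e].
by rewrite rmorph_prod big_map.
Qed.

End Twists.

Definition nilpotent_elt (R : comPzRingType) (x : R) : Prop :=
  exists n : nat, x ^+ n = 0.

(* The spectrum of [R] is irreducible iff the nilradical of [R] is prime. *)
Definition irreducible_spec (R : comPzRingType) : Prop :=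
  ~ nilpotent_elt (1 : R) /\
  forall x y : R, nilpotent_elt (x * y) -> nilpotent_elt x \/ nilpotent_elt y.

(* Additive valuations; the value at 0 is irrelevant and left unconstrained. *)
Record is_valuation (K : fieldType) (G : realDomainType) (v : K -> G) : Prop :=
  IsValuation {
    valuationM : forall x y, x != 0 -> y != 0 -> v (x * y) = v x + v y;
    valuationD : forall x y, x != 0 -> y != 0 -> x + y != 0 ->
      Num.min (v x) (v y) <= v (x + y) }.

Section FunctionFields.
Variables (F K : fieldType) (iota : {rmorphism F -> K}).

Definition is_function_field : Prop :=
  exists x : K, ~ algebraicOver iota x /\
  exists (n : nat) (e : 'I_n -> K), forall y : K,
  exists p q : 'I_n -> {poly F},
    (forall i, (map_poly iota (q i)).[x] != 0) /\
    y = \sum_i (map_poly iota (p i)).[x] / (map_poly iota (q i)).[x] * e i.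

Definition geometrically_irreducible : Prop :=
  forall (F' : fieldType) (j : {rmorphism F -> F'}),
    irreducible_spec (algTens iota j).

Record place := Place {
  ord :> K -> int;
  ord_valuation : is_valuation ord;
  ord_const : forall c, c != 0 -> ord (iota c) = 0;
  ord_uniformizer : exists2 x, x != 0 & ord x = 1 }.

Definition same_place (P Q : place) : Prop := forall x, x != 0 -> P x = Q x.

End FunctionFields.

(* A smooth projective curve is determined by its function field: its closed
   points are the places, and a function is regular at P iff [0 <= ord P]. *)
Record curve (F : finFieldType) := Curve {
  ffield : fieldType;
  fconst : {rmorphism F -> ffield};
  ffieldP : is_function_field fconst;
  curve_irr : geometrically_irreducible fconst }.

Definition closed_point (F : finFieldType) (C : curve F) := place (fconst C).

Section CoordinateRing.
Variables (F : finFieldType) (C : curve F) (oo : closed_point C).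
Local Notation K := (ffield C).

Definition regular_off : {pred K} := fun x =>
  `[< forall P : closed_point C, ~ same_place P oo -> x != 0 -> 0 <= P x >].

Lemma place1 (P : closed_point C) : P 1 = 0.
Proof.
have := valuationM (ord_valuation P) (oner_neq0 K) (oner_neq0 K).
by rewrite mulr1 => e; apply: (addrI (P 1)); rewrite addr0.
Qed.

Lemma placeN (P : closed_point C) x : x != 0 -> P (- x) = P x.
Proof.
move=> x0; have m1 : (-1 : K) != 0 by rewrite oppr_eq0 oner_eq0.
have := valuationM (ord_valuation P) m1 m1.
rewrite mulrNN mulr1 place1 -mulr2n => /esym/eqP; rewrite mulrn_eq0 /= => /eqP e.
by rewrite -mulN1r (valuationM (ord_valuation P)) // e add0r.
Qed.

Fact regular_off_subring : GRing.subring_closed regular_off.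
Proof.
split=> [|x y /asboolP hx /asboolP hy|x y /asboolP hx /asboolP hy];
  apply/asboolP => P Poo nz.
- by rewrite place1.
- have [x0|x0] := eqVneq x 0.
    have y0 : y != 0 by move: nz; rewrite x0 sub0r oppr_eq0.
    by rewrite x0 sub0r placeN // hy.
  have [y0|y0] := eqVneq y 0; first by rewrite y0 subr0 hx.
  have Ny0 : - y != 0 by rewrite oppr_eq0.
  apply: le_trans (valuationD (ord_valuation P) x0 Ny0 nz).
  by rewrite le_min placeN // hx // hy.
- move: nz; rewrite mulf_eq0 negb_or => /andP[x0 y0].
  by rewrite (valuationM (ord_valuation P)) // addr_ge0 ?hx ?hy.
Qed.
HB.instance Definition _ :=
  GRing.isSubringClosed.Build K regular_off regular_off_subring.

Record coordRing := CoordRing { cval :> K; _ : cval \in regular_off }.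
HB.instance Definition _ := [isSub for cval].
HB.instance Definition _ := [Choice of coordRing by <:].
HB.instance Definition _ := [SubChoice_isSubComNzRing of coordRing by <:].

Lemma fconst_regular c : fconst C c \in regular_off.
Proof.
apply/asboolP => P _; rewrite fmorph_eq0 => c0.
by rewrite (ord_const P c0).
Qed.

Definition coord_const (c : F) : coordRing := CoordRing (fconst_regular c).

Fact coord_const_additive : nmod_morphism coord_const.
Proof. by split=> [|x y]; apply: val_inj; rewrite /= ?rmorph0 ?rmorphD. Qed.
Fact coord_const_monoid : monoid_morphism coord_const.
Proof. by split=> [|x y]; apply: val_inj; rewrite /= ?rmorph1 ?rmorphM. Qed.
HB.instance Definition _ :=
  GRing.isNmodMorphism.Build F coordRing coord_const coord_const_additive.
HB.instance Definition _ :=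
  GRing.isMonoidMorphism.Build F coordRing coord_const coord_const_monoid.

End CoordinateRing.

(* A completion of an algebraic closure of K at a place above oo. Such a place
   is given by the Q-valued valuation extending [ord oo]. *)
Record completedClosure (F : finFieldType) (C : curve F) (oo : closed_point C) :=
  CompletedClosure {
    Kbar : fieldType;
    Kbar_in : {rmorphism ffield C -> Kbar};
    Kbar_closed : GRing.closed_field_axiom Kbar;
    Kbar_algebraic : forall y, algebraicOver Kbar_in y;
    Kbar_val : Kbar -> rat;
    Kbar_valuation : is_valuation Kbar_val;
    Kbar_above : forall x, x != 0 -> Kbar_val (Kbar_in x) = (oo x)%:~R;
    Cinf :> fieldType;
    Cinf_in : {rmorphism Kbar -> Cinf};
    Cinf_val : Cinf -> rat;
    Cinf_valuation : is_valuation Cinf_val;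
    Cinf_extends : forall y, y != 0 -> Cinf_val (Cinf_in y) = Kbar_val y;
    Cinf_dense : forall (z : Cinf) (N : rat), exists y : Kbar,
      z - Cinf_in y != 0 -> N <= Cinf_val (z - Cinf_in y);
    Cinf_complete : forall u : nat -> Cinf,
      (forall N : rat, exists n0, forall m n, (n0 <= m)%N -> (n0 <= n)%N ->
         u m - u n != 0 -> N <= Cinf_val (u m - u n)) ->
      exists l, forall N : rat, exists n0, forall n, (n0 <= n)%N ->
        u n - l != 0 -> N <= Cinf_val (u n - l) }.

Section TensorAL.
Variables (F : finFieldType) (C : curve F) (oo : closed_point C).
Variables (L : fieldType) (ell : {rmorphism ffield C -> L}).
Local Notation A := (coordRing oo).

Definition Lconst : {rmorphism F -> L} := ell \o fconst C.

Definition tensAL : Type := algTens (coord_const oo) Lconst.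
HB.instance Definition _ := GRing.ComPzRing.on tensAL.

Let A_K : {rmorphism A -> ffield C} := val.
Let AK_const c : A_K (coord_const oo c) = fconst C c.
Proof. by []. Qed.
Let emb (x : tensAL) : algTens (fconst C) Lconst :=
  algTens_map (fconst C) Lconst A_K idfun x.
Let emb_monoid : monoid_morphism emb.
Proof. exact: algTens_map_monoid. Qed.

Fact tensAL_neq0 : (1 : tensAL) != 0.
Proof.
apply/eqP=> e; have [n1 _] := @curve_irr _ C _ Lconst.
by apply: n1; exists 1%N; rewrite expr1 -emb_monoid.1 e /emb algTens_map0.
Qed.
HB.instance Definition _ := GRing.PzSemiRing_isNonZero.Build tensAL tensAL_neq0.

Fact tensAL_integral : GRing.integral_domain_axiom tensAL.
Proof.
move=> x y xy; have [_ irr] := @curve_irr _ C _ Lconst.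
have [] := irr (emb x) (emb y).
- exists 1%N; rewrite expr1 -emb_monoid.2 xy /emb algTens_map0 //.
- move=> [n xn]; apply/orP; left; apply/eqP.
  exact: (algTens_nilp_eq0 (h := A_K) AK_const val_inj xn).
- move=> [n yn]; apply/orP; right; apply/eqP.
  exact: (algTens_nilp_eq0 (h := A_K) AK_const val_inj yn).
Qed.

Let unitAL : {pred tensAL} := fun x => `[< exists y : tensAL, y * x = 1 >].
Let invAL (x : tensAL) : tensAL :=
  if pselect (exists y : tensAL, y * x = 1) is left h then sval (cid h) else x.
Fact invAL_mulV : {in unitAL, left_inverse 1 invAL *%R}.
Proof.
move=> x /asboolP ux; rewrite /invAL; case: pselect => // h.
exact: (svalP (cid h)).
Qed.
Fact invAL_unit (x y : tensAL) : y * x = 1 -> unitAL x.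
Proof. by move=> e; apply/asboolP; exists y. Qed.
Fact invAL_out : {in [predC unitAL], invAL =1 id}.
Proof.
by move=> x /asboolP nx; rewrite /invAL; case: pselect.
Qed.
HB.instance Definition _ := GRing.ComNzRing_hasMulInverse.Build tensAL
  invAL_mulV invAL_unit invAL_out.
HB.instance Definition _ :=
  GRing.ComUnitRing_isIntegral.Build tensAL tensAL_integral.

Definition tauAL (x : tensAL) : tensAL :=
  algTens_map (coord_const oo) Lconst idfun (frob Lconst) x.

Let tau_f c : @idfun A (coord_const oo c) = coord_const oo c.
Proof. by []. Qed.
Fact tauAL_additive : nmod_morphism tauAL.
Proof.
split; [exact: (algTens_map0 tau_f (frob_base Lconst))|].
exact: (algTens_mapD tau_f (frob_base Lconst)).
Qed.
Fact tauAL_monoid : monoid_morphism tauAL.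
Proof. exact: (algTens_map_monoid tau_f (frob_base Lconst)). Qed.
HB.instance Definition _ :=
  GRing.isNmodMorphism.Build tensAL tensAL tauAL tauAL_additive.
HB.instance Definition _ :=
  GRing.isMonoidMorphism.Build tensAL tensAL tauAL tauAL_monoid.

Definition tensor (a : A) (l : L) : tensAL := apure (coord_const oo) Lconst a l.

Lemma tauAL_tensor a l : tauAL (tensor a l) = tensor a (l ^+ #|F|).
Proof. exact: (algTens_map_pure tau_f (frob_base Lconst)). Qed.

End TensorAL.

(* [p] is a morphism of [F_q]-vector space schemes [G_a^d -> G_a] over [L]: it
   induces [F_q]-linear maps [S^d -> S] on the points in every [L]-algebra [S]. *)
Definition Fq_linear (F L : fieldType) (g : {rmorphism F -> L}) (d : nat)
    (p : {mpoly L[d]}) : Prop :=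
  forall (S : comNzRingType) (j : {rmorphism L -> S}),
    (forall x y : 'I_d -> S,
       mmap j (fun i => x i + y i) p = mmap j x p + mmap j y p) /\
    (forall (c : F) (x : 'I_d -> S),
       mmap j (fun i => j (g c) * x i) p = j (g c) * mmap j x p).

Lemma mmap_comp (L : fieldType) (S : comNzRingType) (j : {rmorphism L -> S})
    (n d : nat) (x : 'I_n -> S) (u : d.-tuple {mpoly L[n]}) (p : {mpoly L[d]}) :
  mmap j x (p \mPo u) = mmap j (fun i => mmap j x (tnth u i)) p.
Proof.
rewrite comp_mpolyE rmorph_sum [RHS]/mmap /=; apply: eq_bigr => m _.
rewrite mmapZ rmorph_prod; congr (_ * _).
by rewrite /mmap1; apply: eq_bigr => i _; rewrite rmorphXn.
Qed.

Lemma comp_mpoly_comp (L : fieldType) (n d e : nat) (v : d.-tuple {mpoly L[n]})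
    (u : e.-tuple {mpoly L[d]}) (p : {mpoly L[e]}) :
  (p \mPo u) \mPo v = p \mPo [tuple tnth u i \mPo v | i < e].
Proof.
rewrite {1}/comp_mpoly mmap_comp /comp_mpoly; apply: eq_bigr => m _.
by congr (_ * _); apply: mmap1_eq => i; rewrite tnth_mktuple.
Qed.

Lemma meval_origin (L : fieldType) (d : nat) (p : {mpoly L[d]}) :
  mmap idfun (fun _ => 0) p = p@_0%MM.
Proof.
have := congr1 (mcoeff 0%MM) (mpolyE p); rewrite raddf_sum /= => ->.
apply: eq_bigr => m _; rewrite mcoeffZ mcoeffX; congr (_ * _).
have [->|m0] := eqVneq m 0%MM; first by rewrite mmap11.
have [i mi] : exists i, m i != 0%N.
  apply: contrapT => h; case/eqP: m0; apply/mnmP => i; rewrite mnm0E.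
  by apply: contrapT => mi; apply: h; exists i; apply/eqP.
by rewrite /mmap1 (bigD1 i) //= expr0n (negPf mi) mul0r.
Qed.

Section LinearClosure.
Variables (F : finFieldType) (L : fieldType) (g : {rmorphism F -> L}) (d : nat).
Implicit Types p q : {mpoly L[d]}.

Definition linear_pred : {pred {mpoly L[d]}} := fun p => `[< Fq_linear g p >].

Fact linear_zmod : zmod_closed linear_pred.
Proof.
split=> [|p q /asboolP hp /asboolP hq]; apply/asboolP => S j.
  by split=> [x y|c x]; rewrite !mmap0 ?addr0 ?mulr0.
have [pD pZ] := hp S j; have [qD qZ] := hq S j.
split=> [x y|c x]; rewrite !mmapB ?pD ?qD ?pZ ?qZ ?mulrBr //.
by rewrite opprD addrACA.
Qed.
HB.instance Definition _ := GRing.isZmodClosed.Build _ linear_pred linear_zmod.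

Lemma linear_pred_scale (l : L) p : p \in linear_pred -> l *: p \in linear_pred.
Proof.
move=> /asboolP hp; apply/asboolP => S j; have [pD pZ] := hp S j.
by split=> [x y|c x]; rewrite !mmapZ ?pD ?pZ ?mulrDr // mulrCA.
Qed.

Lemma linear_pred_frob p : p \in linear_pred -> p ^+ #|F| \in linear_pred.
Proof.
move=> /asboolP hp; apply/asboolP => S j; have [pD pZ] := hp S j.
pose jg : {rmorphism F -> S} := j \o g.
split=> [x y|c x]; rewrite !rmorphXn /=.
  by rewrite pD -![_ ^+ _]/(frob jg _) rmorphD.
by rewrite pZ exprMn -[j (g c) ^+ _]/(frob jg (jg c)) frob_base.
Qed.

Lemma linear_comp (u : d.-tuple {mpoly L[d]}) p :
  (forall i, Fq_linear g (tnth u i)) -> p \in linear_pred ->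
  p \mPo u \in linear_pred.
Proof.
move=> hu /asboolP hp; apply/asboolP => S j; have [pD pZ] := hp S j.
split=> [x y|c x]; rewrite !mmap_comp.
  by rewrite -pD; apply: eq_bigr => m _; congr (_ * _); apply: mmap1_eq => i;
     have [-> _] := hu i S j.
by rewrite -pZ; apply: eq_bigr => m _; congr (_ * _); apply: mmap1_eq => i;
   have [_ ->] := hu i S j.
Qed.

Lemma linear_X i : 'X_i \in linear_pred.
Proof. by apply/asboolP => S j; split=> *; rewrite !mmapX !mmap1U. Qed.

Lemma linear_compD p (u v : d.-tuple {mpoly L[d]}) : p \in linear_pred ->
  p \mPo [tuple tnth u i + tnth v i | i < d] = (p \mPo u) + (p \mPo v).
Proof.
move=> /asboolP hp; have [pD _] := hp _ (@mpolyC d L).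
transitivity (mmap (@mpolyC d L) (fun i => tnth u i + tnth v i) p);
  last exact: pD.
apply: eq_bigr => m _; congr (_ * _).
by apply: mmap1_eq => i; rewrite tnth_mktuple.
Qed.

Lemma linear_compZ p (c : F) : p \in linear_pred ->
  p \mPo [tuple g c *: 'X_i | i < d] = g c *: p.
Proof.
move=> /asboolP hp; have [_ pZ] := hp _ (@mpolyC d L).
rewrite -[in RHS](comp_mpoly_id p) -mul_mpolyC.
transitivity (mmap (@mpolyC d L)
  (fun i => (g c)%:MP * tnth [tuple 'X_i | i < d] i) p); last exact: pZ.
apply: eq_bigr => m _; congr (_ * _).
by apply: mmap1_eq => i; rewrite !tnth_mktuple mul_mpolyC.
Qed.

Lemma linear_coef0 p : p \in linear_pred -> p@_0%MM = 0.
Proof.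
move=> /asboolP hp; have [pD _] := hp L idfun.
have e2 : mmap idfun (fun _ => 0 + 0) p = mmap idfun (fun _ => 0) p.
  by apply: eq_bigr => m _; congr (_ * _); apply: mmap1_eq => i; rewrite addr0.
have := pD (fun _ => 0) (fun _ => 0); rewrite e2 meval_origin => h.
by apply: (addrI (p@_0%MM)); rewrite addr0.
Qed.

End LinearClosure.

Section Vanishing.
Variables (L : fieldType) (d : nat).
Implicit Types p q : {mpoly L[d]}.

Definition vanishes k p : Prop := forall m, (mdeg m < k)%N -> p@_m = 0.

Lemma vanishes0 k : vanishes k 0.
Proof. by move=> m _; rewrite mcoeff0. Qed.

Lemma vanishesD k p q : vanishes k p -> vanishes k q -> vanishes k (p + q).
Proof. by move=> hp hq m mk; rewrite mcoeffD hp ?hq ?addr0. Qed.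

Lemma vanishesM a b p q : vanishes a p -> vanishes b q ->
  vanishes (a + b) (p * q).
Proof.
move=> hp hq m mk; rewrite mcoeffM big1 // => -[[m1 h1] [m2 h2]] /= /eqP mE.
have [lt|ge] := ltnP (mdeg m1) a; first by rewrite hp ?mul0r.
rewrite hq ?mulr0 //; move: mk; rewrite mE mdegD => lt.
by rewrite -(ltn_add2l a); apply: leq_ltn_trans lt; rewrite leq_add2r.
Qed.

Lemma vanishes_le a b p : (b <= a)%N -> vanishes a p -> vanishes b p.
Proof. by move=> ba hp m mb; apply: hp; apply: leq_trans mb ba. Qed.

Lemma vanishesX a p n : vanishes a p -> vanishes (a * n) (p ^+ n).
Proof.
move=> hp; elim: n => [|n IH]; first by rewrite muln0 => m.
by rewrite exprS mulnS; apply: vanishesM.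
Qed.

Lemma vanishes_comp a k p (u : d.-tuple {mpoly L[d]}) :
  (forall i, vanishes a (tnth u i)) -> vanishes k p ->
  vanishes (a * k) (p \mPo u).
Proof.
move=> hu hp; rewrite comp_mpolyE.
elim/big_ind: _ => [||m _]; [exact: vanishes0|exact: vanishesD|].
have [mk|km] := ltnP (mdeg m) k; first by rewrite hp // scale0r; apply: vanishes0.
move=> m' m'k; rewrite mcoeffZ.
suff h : vanishes (a * mdeg m) (\prod_(i < d) tnth u i ^+ m i).
  by rewrite h ?mulr0 //; apply: leq_trans m'k _; rewrite leq_mul2l km orbT.
rewrite mdegE big_distrr /=.
elim/big_rec2: _ => [|i y x _ h]; first by move=> ?.
by apply: vanishesM => //; apply: vanishesX.
Qed.

Lemma vanishes_eq0 p : (forall k, vanishes k p) -> p = 0.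
Proof.
by move=> h; apply/mpolyP => m; rewrite mcoeff0; apply: (h (mdeg m).+1).
Qed.

End Vanishing.

(* The Jacobian matrix at the origin, i.e. the action on [Lie G_a^d = L^d]. *)
Definition lie (L : fieldType) (d : nat) (u : d.-tuple {mpoly L[d]}) : 'M[L]_d :=
  \matrix_(i, j) (mderiv j (tnth u i)).@[fun _ => 0].

Lemma lieE (L : fieldType) (d : nat) (u : d.-tuple {mpoly L[d]}) i j :
  lie u i j = (tnth u i)@_U_(j).
Proof.
rewrite mxE /meval meval_origin mcoeff_deriv add0m mnmE.
by rewrite mulr1n.
Qed.

Section LinearPart.
Variables (L : fieldType) (d : nat).

Lemma lie_comp (p : {mpoly L[d]}) (u : d.-tuple {mpoly L[d]}) j :
  vanishes 1 p -> (forall i, vanishes 1 (tnth u i)) ->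
  (p \mPo u)@_U_(j) = \sum_i p@_U_(i) * (tnth u i)@_U_(j).
Proof.
move=> hp hu.
pose p1 := \sum_i p@_U_(i) *: 'X_i.
have h2 : vanishes 2 (p - p1).
  move=> m; rewrite ltnS leq_eqVlt ltnS leqn0 => /orP[].
    move=> /mdeg1P[i /eqP->]; rewrite mcoeffB raddf_sum (bigD1 i) //=.
    rewrite mcoeffZ mcoeffXU eqxx mulr1 big1 ?addr0 ?subrr // => k ki.
    by rewrite mcoeffZ mcoeffXU (negPf ki) mulr0.
  rewrite mdeg_eq0 => /eqP->; rewrite mcoeffB hp ?mdeg0 // raddf_sum big1 ?subrr //=.
  by move=> k _; rewrite mcoeffZ mcoeffX mnm1_eq0 mulr0.
have := vanishes_comp hu h2; rewrite mul1n => /(_ U_(j)%MM); rewrite mdeg1.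
move=> /(_ isT); rewrite comp_mpolyB mcoeffB => /eqP; rewrite subr_eq0 => /eqP->.
rewrite /p1 (raddf_sum (comp_mpoly u)) raddf_sum /=; apply: eq_bigr => i _.
by rewrite comp_mpolyZ mcoeffZ comp_mpolyXU -tnth_nth.
Qed.

End LinearPart.

(* Coordinates are chosen on E: [E = G_a^d], and an endomorphism of the
   [F_q]-vector space scheme [G_a^d] is a d-tuple of [F_q]-linear polynomials in
   d variables. *)
Record andersonModule (F : finFieldType) (C : curve F) (oo : closed_point C)
    (L : fieldType) (ell : {rmorphism ffield C -> L}) := AndersonModule {
  adim : nat;
  aphi : coordRing oo -> adim.-tuple {mpoly L[adim]};
  aphi_linear : forall a i, Fq_linear (Lconst ell) (tnth (aphi a) i);
  aphi1 : forall i, tnth (aphi 1) i = 'X_i;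
  aphiD : forall a b i,
    tnth (aphi (a + b)) i = tnth (aphi a) i + tnth (aphi b) i;
  aphiM : forall a b i, tnth (aphi (a * b)) i = tnth (aphi a) i \mPo aphi b;
  aphi_lie : forall a, exists n : nat, (lie (aphi a) - (ell (cval a))%:M) ^+ n = 0 }.

Section Motive.
Variables (F : finFieldType) (C : curve F) (oo : closed_point C).
Variables (L : fieldType) (ell : {rmorphism ffield C -> L}).
Variable E : andersonModule oo ell.
Local Notation A := (coordRing oo).
Local Notation d := (adim E).
Local Notation phi := (aphi E).
Local Notation g := (Lconst ell).
Local Notation lin := (@linear_pred F L g d).
Implicit Types p : {mpoly L[d]}.

Lemma linear_comp_aphi p a : p \in lin -> p \mPo phi a \in lin.
Proof. by apply: linear_comp; apply: aphi_linear. Qed.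

Lemma comp_aphiM p a b : p \mPo phi (a * b) = (p \mPo phi a) \mPo phi b.
Proof.
rewrite comp_mpoly_comp; apply: eq_bigr => m _; congr (_ * _).
by apply: mmap1_eq => i; rewrite tnth_mktuple aphiM.
Qed.

Lemma comp_aphi1 p : p \mPo phi 1 = p.
Proof.
rewrite -[RHS]comp_mpoly_id; apply: eq_bigr => m _; congr (_ * _).
by apply: mmap1_eq => i; rewrite tnth_mktuple aphi1.
Qed.

Lemma comp_aphiD p a b : p \in lin ->
  p \mPo phi (a + b) = (p \mPo phi a) + (p \mPo phi b).
Proof.
move=> hp; rewrite -(linear_compD _ _ hp); apply: eq_bigr => m _.
by congr (_ * _); apply: mmap1_eq => i; rewrite tnth_mktuple aphiD.
Qed.

Lemma linear_vanishes1 p : p \in lin -> vanishes 1 p.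
Proof.
move=> hp m; rewrite ltnS leqn0 mdeg_eq0 => /eqP->; exact: linear_coef0 hp.
Qed.

(* That [phi] is [F_q]-linear is not assumed: [phi_c] is multiplication by [c]
   because [phi_(c^q) = phi_c] and [d phi_c - c] is nilpotent. Without this the
   motive would not be a module over the tensor product over [F_q]. *)
Section Constants.
Variable c : F.
Let fc := phi (coord_const oo c).
Let Y : d.-tuple {mpoly L[d]} := [tuple tnth fc i - g c *: 'X_i | i < d].
Let N p := p \mPo Y.

Let Y_lin i : tnth Y i \in lin.
Proof.
have h1 : g c *: 'X_i \in lin by apply: linear_pred_scale; apply: linear_X.
have h2 : tnth fc i \in lin by apply/asboolP; apply: aphi_linear.
by rewrite tnth_mktuple; apply: rpredB.
Qed.

Let N_lin p : p \in lin -> N p \in lin.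
Proof. by apply: linear_comp => i; apply/asboolP; apply: Y_lin. Qed.

Let fcE p : p \in lin -> p \mPo fc = g c *: p + N p.
Proof.
move=> hp; rewrite -(linear_compZ c hp) /N -(linear_compD _ _ hp).
apply: eq_bigr => m _; congr (_ * _); apply: mmap1_eq => i.
by rewrite !tnth_mktuple addrC subrK.
Qed.

Let linD p q : p \in lin -> q \in lin -> p + q \in lin.
Proof. exact: rpredD. Qed.
Let NZ l p : N (l *: p) = l *: N p.
Proof. exact: comp_mpolyZ. Qed.
Let ND p q : N (p + q) = N p + N q.
Proof. exact: comp_mpolyD. Qed.

Let fc_pow p n : p \in lin -> exists2 r, r \in lin &
  p \mPo phi (coord_const oo (c ^+ n)) =
  g (c ^+ n) *: p + (g (c ^+ n.-1) *+ n) *: N p + N (N r).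
Proof.
move=> hp; elim: n => [|n [r hr IH]].
  exists 0; first exact: rpred0.
  rewrite !expr0 !rmorph1 comp_aphi1 mulr0n scale0r scale1r /N.
  by rewrite !comp_mpoly0 !addr0.
exists (g c *: r + (g (c ^+ n.-1) *+ n) *: p + N r).
  by rewrite !linD ?linear_pred_scale ?N_lin ?linear_pred_scale.
rewrite exprSr (rmorphM (coord_const oo)) comp_aphiM IH -/fc fcE; last first.
  by rewrite !linD ?linear_pred_scale ?N_lin ?linear_pred_scale.
rewrite !ND !NZ !scalerDr !scalerA rmorphM /=.
rewrite [g (c ^+ n) * g c]mulrC -!addrA; congr (_ + _).
have -> : g c * (g (c ^+ n.-1) *+ n) = g (c ^+ n) *+ n.
  case: n {IH} => [|n]; first by rewrite !mulr0n mulr0.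
  by rewrite mulrnAr -rmorphM -exprS.
rewrite mulrSr scalerDl -!addrA; congr (_ + _).
by rewrite [RHS]addrCA; congr (_ + _); rewrite [RHS]addrC -addrA.
Qed.

Let N_sq p : p \in lin -> exists2 r, r \in lin & N p = N (N r).
Proof.
move=> hp; have [r hr] := fc_pow #|F| hp; rewrite expf_card -/fc fcE //.
have [l [e [pl lF qE]]] := card_fin_field F.
have e0 : e != 0%N.
  by have := finNzRing_gt1 F; rewrite qE; case: (e).
have q0 : #|F|%:R = 0 :> L.
  by rewrite qE natrX (rmorph_pchar0 g lF) expr0n (negPf e0).
rewrite -[in _ *+ _]mulr_natr q0 mulr0 scale0r addr0 => /addrI NE.
by exists r.
Qed.

Let N_iter p k : p \in lin -> exists2 r, r \in lin & N p = iter k N (N r).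
Proof.
move=> hp; elim: k => [|k [r hr ->]]; first by exists p.
by have [r' hr' ->] := N_sq hr; exists r' => //; rewrite iterSr.
Qed.

Let iterN_comp p n : iter n N p = p \mPo [tuple iter n N 'X_i | i < d].
Proof.
elim: n => [|n IH] /=; first by rewrite comp_mpoly_id.
rewrite IH {1}/N comp_mpoly_comp; apply: eq_bigr => m _; congr (_ * _).
by apply: mmap1_eq => i; rewrite !tnth_mktuple.
Qed.

Let iterN_lin p n : p \in lin -> iter n N p \in lin.
Proof. by move=> hp; elim: n => //= n; apply: N_lin. Qed.

Let iterN_lie p n j : p \in lin ->
  (iter n N p)@_U_(j) = \sum_i p@_U_(i) * (lie Y ^+ n) i j.
Proof.
move=> hp; elim: n j => [|n IH] j /=.
  rewrite expr0 (bigD1 j) //= mxE eqxx mulr1 big1 ?addr0 // => i ij.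
  by rewrite mxE (negPf ij) mulr0.
rewrite lie_comp; [|exact/linear_vanishes1/iterN_lin|
                   by move=> i; apply/linear_vanishes1/Y_lin].
transitivity (\sum_i \sum_k p@_U_(k) * (lie Y ^+ n) k i * (tnth Y i)@_U_(j)).
  by apply: eq_bigr => i _; rewrite -mulr_suml -IH.
rewrite exchange_big; apply: eq_bigr => i _; rewrite exprSr mxE mulr_sumr.
by apply: eq_bigr => k _; rewrite lieE mulrA.
Qed.

Let lieY : lie Y = lie fc - (g c)%:M.
Proof.
apply/matrixP => i j; rewrite lieE !mxE -[RHS]/(_ - _) tnth_mktuple.
rewrite mcoeffB mcoeffZ mcoeffXU -(lieE fc) mxE mulr_natr.
by [].
Qed.

Lemma comp_const p : p \in lin -> p \mPo phi (coord_const oo c) = g c *: p.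
Proof.
move=> hp; rewrite -/fc fcE //.
suff -> : N p = 0 by rewrite addr0.
have [n nil] := aphi_lie E (coord_const oo c).
have Zn i : vanishes 2 (iter n N 'X_i).
  move=> m; rewrite ltnS leq_eqVlt ltnS leqn0 => /orP[/mdeg1P[j /eqP->]|].
    rewrite iterN_lie ?linear_X // lieY nil.
    by rewrite big1 // => k _; rewrite mxE mulr0.
  rewrite mdeg_eq0 => /eqP->; apply: (linear_coef0 (g := g)).
  exact/iterN_lin/linear_X.
have van r k : vanishes 1 r -> vanishes (2 ^ k) (iter (k * n) N r).
  move=> hr; elim: k => [|k IH]; first by [].
  rewrite mulSn iterD iterN_comp expnS; apply: vanishes_comp => // i.
  by rewrite tnth_mktuple.
apply: vanishes_eq0 => k; have [r hr ->] := N_iter (k * n) hp.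
apply: vanishes_le (van _ k _); first exact/ltnW/ltn_expl.
exact/linear_vanishes1/N_lin.
Qed.

End Constants.

Record motive := MkMotive { mpol :> {mpoly L[d]}; _ : mpol \in lin }.
HB.instance Definition _ := [isSub for mpol].
HB.instance Definition _ := [Choice of motive by <:].
HB.instance Definition _ := [SubChoice_isSubZmodule of motive by <:].

Lemma motiveP (m : motive) : (m : {mpoly L[d]}) \in lin.
Proof. exact: valP. Qed.

Definition mscale (l : L) (m : motive) : motive :=
  MkMotive (linear_pred_scale l (motiveP m)).
Definition mcomp (a : coordRing oo) (m : motive) : motive :=
  MkMotive (linear_comp_aphi a (motiveP m)).
Definition mfrob (m : motive) : motive := MkMotive (linear_pred_frob (motiveP m)).

Let act (m : motive) (a : restr (coord_const oo) (coordRing oo)^o)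
    (l : restr g L^o) : motive := mscale l (mcomp a m).

Let act_bal m : balanced (act m).
Proof.
split=> [a a' l|a l l'|r a l]; apply: val_inj => /=.
- by rewrite comp_aphiD ?motiveP // scalerDr.
- by rewrite scalerDl.
- change ((l : L) *: (mpol m \mPo phi (coord_const oo r * a)) =
          (g r * (l : L)) *: (mpol m \mPo phi a)).
  rewrite [_ * a]mulrC comp_aphiM comp_const; last exact/linear_comp_aphi/motiveP.
  by rewrite scalerA [_ * l]mulrC.
Qed.

Definition motive_scale (t : tensAL oo ell) (m : motive) : motive :=
  tens_lift (act m) t.

Lemma motive_scale_tensor a l m :
  motive_scale (tensor ell a l) m = mscale l (mcomp a m).
Proof. exact: (tens_lift_pure _ _ (act_bal m)). Qed.

Let motive_scaleDl m : {morph motive_scale^~ m : t t' / t + t'}.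
Proof. exact: (tens_liftD (act_bal m)). Qed.

Let motive_scaleDr : right_distributive motive_scale +%R.
Proof.
move=> t m m'; rewrite /motive_scale /tens_lift /fsum_eval -big_split /=.
apply: eq_bigr => -[a l] _; apply: val_inj => /=.
by rewrite comp_mpolyD scalerDr.
Qed.

Let motive_scaleA t t' m :
  motive_scale t (motive_scale t' m) = motive_scale (t * t') m.
Proof.
apply: (algTens_ext (u := fun t => motive_scale t (motive_scale t' m))
          (v := fun t => motive_scale (t * t') m)) => [x y|x y|a l] /=.
- by rewrite motive_scaleDl.
- by rewrite mulrDl motive_scaleDl.
apply: (algTens_ext (u := fun t' => motive_scale (tensor ell a l) (motive_scale t' m))
          (v := fun t' => motive_scale (tensor ell a l * t') m))
  => [x y|x y|a' l'] /=.
- by rewrite motive_scaleDl motive_scaleDr.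
- by rewrite mulrDr motive_scaleDl.
rewrite apureM -!/(tensor ell _ _) !motive_scale_tensor.
apply: val_inj => /=.
by rewrite comp_mpolyZ scalerA -comp_aphiM [a' * a]mulrC.
Qed.

Let motive_scale1 : left_id 1 motive_scale.
Proof.
move=> m; rewrite -apure1 -/(tensor ell 1 1) motive_scale_tensor.
by apply: val_inj; rewrite /= comp_aphi1 scale1r.
Qed.

HB.instance Definition _ := GRing.Zmodule_isLmodule.Build (tensAL oo ell) motive
  motive_scaleA motive_scale1 motive_scaleDr motive_scaleDl.

Lemma motive_tensorE a l (m : motive) :
  tensor ell a l *: m = l *: ((m : {mpoly L[d]}) \mPo phi a) :> {mpoly L[d]}.
Proof. by rewrite -[_ *: m]/(motive_scale _ _) motive_scale_tensor. Qed.

End Motive.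

Section MotiveFrobenius.
Variables (F : finFieldType) (C : curve F) (oo : closed_point C).
Variables (L : fieldType) (ell : {rmorphism ffield C -> L}).
Variable E : andersonModule oo ell.

Lemma mfrobD (m m' : motive E) : mfrob (m + m') = mfrob m + mfrob m'.
Proof.
apply: val_inj => /=.
have L0 p : p \in [pchar F] -> p%:R = 0 :> {mpoly L[adim E]}.
  by move=> pF; rewrite -(rmorph_nat (@mpolyC (adim E) L))
    (rmorph_pchar0 (Lconst ell) pF) rmorph0.
by have := exprD_card 1 (mpol m) (mpol m') L0; rewrite expn1.
Qed.

Lemma mfrobZ (t : tensAL oo ell) (m : motive E) :
  mfrob (t *: m) = tauAL t *: mfrob m.
Proof.
apply: (algTens_ext (u := fun t => mfrob (t *: m))
          (v := fun t => tauAL t *: mfrob m)) => [x y|x y|a l] /=.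
- by rewrite scalerDl mfrobD.
- by rewrite -scalerDl -rmorphD.
rewrite -!/(tensor ell a l) tauAL_tensor; apply: val_inj => /=.
rewrite !motive_tensorE /= exprZn.
by congr (_ *: _); rewrite rmorphXn.
Qed.

End MotiveFrobenius.

Definition fin_generated (R : comPzRingType) (V : lmodType R) : Prop :=
  exists (n : nat) (e : 'I_n -> V),
    forall v, exists c : 'I_n -> R, v = \sum_i c i *: e i.

Definition is_free (R : comPzRingType) (V : lmodType R) : Prop :=
  exists (I : choiceType) (e : I -> V),
    (forall v, exists (s : seq I) (c : I -> R), v = \sum_(i <- s) c i *: e i) /\
    (forall (s : seq I) (c : I -> R), uniq s -> \sum_(i <- s) c i *: e i = 0 ->
       forall i, i \in s -> c i = 0).

Definition semilinear_endo (R : comPzRingType) (tau : R -> R) (V : lmodType R)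
    (sigma : V -> V) : Prop :=
  (forall x y, sigma (x + y) = sigma x + sigma y) /\
  (forall a x, sigma (a *: x) = tau a *: sigma x).

Section LocalizedMotive.
Variables (F : finFieldType) (C : curve F) (oo : closed_point C).
Variables (L : fieldType) (ell : {rmorphism ffield C -> L}).
Variable E : andersonModule oo ell.

Definition genericMotive : lmodType {fraction tensAL oo ell} :=
  baseChange (@tofrac (tensAL oo ell) : {rmorphism tensAL oo ell -> {fraction tensAL oo ell}})
    (motive E).

Definition tau_morphism : {rmorphism tensAL oo ell -> tensAL oo ell} :=
  @tauAL F C oo L ell.

Definition locRing (f : tensAL oo ell) : comPzRingType := loc (twists tau_morphism f).

Definition locRing_tau (f : tensAL oo ell) : {rmorphism locRing f -> locRing f} :=
  loc_map (@twists_stable _ tau_morphism f).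

Definition locRing_in (f : tensAL oo ell) :
    {rmorphism tensAL oo ell -> locRing f} :=
  toloc (twists tau_morphism f).

Definition locMotive (f : tensAL oo ell) : lmodType (locRing f) :=
  baseChange (locRing_in f) (motive E).

Definition locMotive_pure (f : tensAL oo ell) (r : locRing f) (m : motive E) :
    locMotive f := bpure (locRing_in f) r m.

Definition locMotive_difference (f : tensAL oo ell) : Prop :=
  exists sigma : locMotive f -> locMotive f,
    semilinear_endo (locRing_tau f) sigma /\
    forall r m, sigma (locMotive_pure r m) =
                locMotive_pure (locRing_tau f r) (mfrob m).

End LocalizedMotive.

(* Main.v *)
(** Choose [a] in [A] transcendental over [F_q]. On the motive, the span of the
    [X_i^(q^l)] with [l <= N] has [L]-dimension [d (N + 1)], and precomposition
    with [phi_a] raises [N] by a constant [r]. If [w_1 .. w_k] are independent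
    over [A (x) L], the [k (s + 1)] elements [a^j w_i], [j <= s], are
    [L]-independent in degrees [N <= n_0 + r s]; letting [s] grow, [k <= d r].
    So there is a maximal independent family [e], and every [m] has a nonzero
    multiple in its span. Taking for [f] a common multiple of such denominators
    for the [X_i] and the [tau e_j] makes the span of [e] over the localization
    stable under [tau], hence everything.

    That [A] has a transcendental element is a counting version of Riemann's
    inequality at the place [oo]. With [x] a uniformizer at [oo], [y = 1/x] and
    [n = [K : F_q(y)]], let [R] be the ring of functions regular at all places
    above [x = 0], so that [dim R/xR <= n]. Take a basis [w_i] of [K] that is
    integral over [F_q[y]] and [u] whose only pole above [x = 0] is [oo]. For
    large [s], the functions [y^j w_i], [j <= s], and [u], [u^2], ... in
    [x^-N R] outnumber [n (N + 1)], so they are dependent modulo [x R]; the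
    [y^j w_i]-part of the relation has no pole outside [oo] and has a zero or a
    pole at [oo]. *)
Require Import Defs.
From HB Require Import structures.
From mathcomp Require Import all_boot all_order all_algebra.
From mathcomp Require Import fraction finfield boolp mpoly.
From mathcomp Require Import ring zify.

Set Implicit Arguments.
Unset Strict Implicit.
Unset Printing Implicit Defensive.

Import Order.TTheory GRing.Theory Num.Theory.
Local Open Scope ring_scope.

(** * Counting *)

(** This supplies maximal independent families and maximal families of distinct places; in each use
    the work lies in the bound [B]. *)
Lemma max_family (X : Type) (Q : forall k, ('I_k -> X) -> Prop) (B : nat) :
  (exists w : 'I_0 -> X, Q 0%N w) -> (forall k w, Q k w -> (k <= B)%N) ->
  exists k (w : 'I_k -> X), Q k w /\ forall k' (w' : 'I_k' -> X), Q k' w' -> (k' <= k)%N.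
Proof.
move=> [w0 Qw0] QB; pose p k := `[< exists w : 'I_k -> X, Q k w >].
have ex : exists k, p k by exists 0%N; apply/asboolP; exists w0.
have ub k : p k -> (k <= B)%N by move=> /asboolP[w /QB].
case: (ex_maxnP ex ub) => k /asboolP[w Qw] kmax.
exists k, w; split=> // k' w' Qw'; apply: kmax.
exact: asboolT (ex_intro _ w' Qw').
Qed.

Definition ocons (X : Type) k (z : X) (w : 'I_k -> X) (i : 'I_k.+1) : X :=
  oapp w z (unlift ord0 i).

Lemma ocons0 (X : Type) k (z : X) (w : 'I_k -> X) : ocons z w ord0 = z.
Proof. by rewrite /ocons unlift_none. Qed.

Lemma oconsS (X : Type) k (z : X) (w : 'I_k -> X) i :
  ocons z w (lift ord0 i) = w i.
Proof. by rewrite /ocons liftK. Qed.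

Definition submodule_pred (F : pzRingType) (V : lmodType F) (U : V -> Prop) : Prop :=
  U 0 /\ forall a x y, U x -> U y -> U (a *: x + y).

Lemma submodule_sum (F : pzRingType) (V : lmodType F) (U : V -> Prop)
    (I : finType) (c : I -> F) (v : I -> V) :
  submodule_pred U -> (forall i, U (v i)) -> U (\sum_i c i *: v i).
Proof.
move=> [U0 UL] Uv; elim/big_rec: _ => // i x _ Ux; exact: UL.
Qed.

(** The coordinates of the [v i] modulo [U] form a matrix with more rows than columns, and a nonzero
    vector of its left kernel is the relation. Working modulo [U] avoids forming the quotient. *)
Lemma pigeonhole_mod (F : fieldType) (V : lmodType F) (U : V -> Prop)
    (I J : finType) (v : I -> V) (g : J -> V) :
  submodule_pred U -> (#|J| < #|I|)%N ->
  (forall i, exists c : J -> F, U (v i - \sum_j c j *: g j)) ->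
  exists c : I -> F, (exists i, c i != 0) /\ U (\sum_i c i *: v i).
Proof.
move=> Usub ltJI vU; have [C CU] := choice vU.
pose A : 'M[F]_(#|I|, #|J|) := \matrix_(i, j) C (enum_val i) (enum_val j).
have /rowV0Pn[u /sub_kermxP uA u0] : kermx A != 0.
  rewrite -mxrank_eq0 mxrank_ker -lt0n subn_gt0.
  exact: leq_ltn_trans (rank_leq_col A) ltJI.
pose c i := u 0 (enum_rank i); exists c; split.
  apply: contrapT => /forallNP c0; case/eqP: u0; apply/rowP => i; rewrite mxE.
  by have /negP := c0 (enum_val i); rewrite negbK /c enum_valK => /eqP.
have cC j : \sum_i c i * C i j = 0.
  have := congr1 (fun B : 'rV_ _ => B 0 (enum_rank j)) uA; rewrite !mxE => {2}<-.
  rewrite (reindex (enum_val : 'I_#|I| -> I)) /=; last first.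
    exact/onW_bij/enum_val_bij.
  by apply: eq_bigr => i _; rewrite /c enum_valK mxE enum_rankK.
have -> : \sum_i c i *: v i = \sum_i c i *: (v i - \sum_j C i j *: g j).
  under [RHS]eq_bigr => i _ do rewrite scalerBr scaler_sumr.
  rewrite sumrB [X in _ - X]exchange_big /= [X in _ - X]big1 ?subr0 // => j _.
  under eq_bigr => i _ do rewrite scalerA.
  by rewrite -scaler_suml cC scale0r.
exact: submodule_sum.
Qed.

(** There are [k (s + 1)] vectors in a space of dimension at most [b + a s], so [a < k] forces a
    relation for large [s]. The generators may vary with [s]. *)
Lemma growth_dependence (F : fieldType) (V : lmodType F) (k a b : nat)
    (v : 'I_k -> nat -> V) :
  (a < k)%N ->
  (forall s, exists (J : finType) (g : J -> V), (#|J| <= b + a * s)%N /\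
     forall i j, (j <= s)%N -> exists c : J -> F, v i j = \sum_l c l *: g l) ->
  exists p : 'I_k -> {poly F}, (exists i, p i != 0) /\
    \sum_i \sum_(j < size (p i)) (p i)`_j *: v i j = 0.
Proof.
(* The choice [s = b] suffices: [k (b + 1)] is at least [(a + 1)(b + 1)], which exceeds
   [b + a b]. *)
move=> ak gen; have [J [g [Jb vg]]] := gen b.
have [] := @pigeonhole_mod F V (fun x => x = 0) ('I_k * 'I_b.+1)%type J
  (fun x => v x.1 x.2) g.
- by split=> // c x y -> ->; rewrite scaler0 addr0.
- rewrite card_prod !card_ord; apply: leq_ltn_trans Jb _.
  nia.
- move=> [i j] /=; have [|c ->] := vg i j; first by rewrite -ltnS.
  by exists c; rewrite subrr.
move=> c [[[i0 j0] c0] cv].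
pose p i := \poly_(j < b.+1) c (i, inord j); exists p; split.
  exists i0; apply/eqP => /(congr1 (fun q : {poly F} => q`_j0)).
  by rewrite coef_poly ltn_ord inord_val coef0; apply/eqP.
transitivity (\sum_i \sum_j c (i, j) *: v i j); last first.
  by rewrite -[RHS]cv pair_bigA; apply: eq_bigr => -[].
apply: eq_bigr => i _.
have sz : (size (p i) <= b.+1)%N by exact: size_poly.
rewrite (big_ord_widen _ (fun j => (p i)`_j *: v i j) sz) big_mkcond /=.
apply: eq_bigr => j _; case: ltnP => [_|le].
  by rewrite coef_poly ltn_ord inord_val.
have := nth_default 0 le; rewrite coef_poly ltn_ord inord_val => ->.
by rewrite scale0r.
Qed.

(** * Places of a field *)

Section Places.
Variables (F K : fieldType) (iota : {rmorphism F -> K}).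
Implicit Types (P Q : place iota) (x y z u : K).

Local Notation ev z p := ((map_poly iota p).[z]).

Lemma ordM P x y : x != 0 -> y != 0 -> P (x * y) = P x + P y.
Proof. exact: (valuationM (ord_valuation P)). Qed.

Lemma ord1 P : P 1 = 0.
Proof. by rewrite -(rmorph1 iota) ord_const ?oner_eq0. Qed.

Lemma ordV P x : x != 0 -> P x^-1 = - P x.
Proof.
move=> x0; apply/eqP; rewrite -addr_eq0 -ordM ?invr_eq0 //.
by rewrite mulVf // ord1.
Qed.

Lemma ordX P x n : x != 0 -> P (x ^+ n) = P x *+ n.
Proof.
move=> x0; elim: n => [|n IH]; first by rewrite ord1.
by rewrite exprS ordM ?expf_neq0 // IH mulrS.
Qed.

Lemma ordXz P x (n : int) : x != 0 -> P (x ^ n) = P x * n.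
Proof.
move=> x0; case: n => n; first by rewrite -exprnP ordX // pmulrn mulrzz.
by rewrite NegzE -exprnN ordV ?expf_neq0 // ordX // pmulrn mulrzz mulrN.
Qed.

(* [ord P 0] is unconstrained, so [0] is given order [+oo] by hand. *)
Definition ord_ge P (k : int) z : bool := (z == 0) || (k <= P z).

Lemma ord_ge_nz P k z : z != 0 -> ord_ge P k z = (k <= P z).
Proof. by rewrite /ord_ge => /negPf->. Qed.

Lemma ord_ge0r P k : ord_ge P k 0.
Proof. by rewrite /ord_ge eqxx. Qed.

Lemma ord_geD P k x y : ord_ge P k x -> ord_ge P k y -> ord_ge P k (x + y).
Proof.
rewrite /ord_ge; case: eqVneq => [->|x0]; first by rewrite add0r.
case: eqVneq => [->|y0]; first by rewrite addr0 (negPf x0).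
case: eqVneq => //= xy0 kx ky.
apply: le_trans (valuationD (ord_valuation P) x0 y0 xy0).
by rewrite le_min kx ky.
Qed.

Lemma ord_geM P k l x y : ord_ge P k x -> ord_ge P l y -> ord_ge P (k + l) (x * y).
Proof.
rewrite /ord_ge mulf_eq0; case: eqVneq => //= x0; case: eqVneq => //= y0.
by rewrite ordM //; apply: lerD.
Qed.

Lemma ord_ge_le P k l x : l <= k -> ord_ge P k x -> ord_ge P l x.
Proof. by rewrite /ord_ge; case: eqVneq => //= _; apply: le_trans. Qed.

Lemma ord_ge_const P c : ord_ge P 0 (iota c).
Proof.
have [->|c0] := eqVneq c 0; first by rewrite rmorph0 ord_ge0r.
by rewrite ord_ge_nz ?fmorph_eq0 // ord_const.
Qed.

Lemma ord_geN P k x : ord_ge P k x -> ord_ge P k (- x).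
Proof.
move=> h; rewrite -mulN1r -[k]add0r; apply: ord_geM => //.
by rewrite -(rmorph1 iota) -rmorphN ord_ge_const.
Qed.

Lemma ord_geB P k x y : ord_ge P k x -> ord_ge P k y -> ord_ge P k (x - y).
Proof. by move=> hx hy; apply: ord_geD => //; apply: ord_geN. Qed.

Lemma ord_ge_sum P k (I : Type) (r : seq I) (Q : pred I) (f : I -> K) :
  (forall i, Q i -> ord_ge P k (f i)) -> ord_ge P k (\sum_(i <- r | Q i) f i).
Proof.
move=> h; apply: (big_ind (fun x => ord_ge P k x)) => // [|x y].
  exact: ord_ge0r.
exact: ord_geD.
Qed.

Lemma ord_ge_constM P k c x : ord_ge P k x -> ord_ge P k (iota c * x).
Proof. by move=> h; rewrite -[k]add0r; apply: ord_geM => //; apply: ord_ge_const. Qed.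

Lemma ord_geX P k x n : ord_ge P k x -> ord_ge P (k *+ n) (x ^+ n).
Proof.
move=> h; elim: n => [|n IH]; last by rewrite exprS mulrS; apply: ord_geM.
by rewrite mulr0n expr0 -(rmorph1 iota) ord_ge_const.
Qed.

(** If [x + y] had order greater than [P x], so would [x], as the difference of [x + y] and [y]. *)
Lemma ordD_lt P x y : x != 0 -> ord_ge P (P x + 1) y -> x + y != 0 /\ P (x + y) = P x.
Proof.
move=> x0 hy; have nx1 : ~~ ord_ge P (P x + 1) x.
  by rewrite ord_ge_nz // gerDl ler10.
have xy0 : x + y != 0.
  apply: contra nx1 => /eqP/(canRL (addrK _)); rewrite add0r => xE.
  by rewrite [X in ord_ge _ _ X]xE; apply: ord_geN.
split=> //; apply: le_anti; apply/andP; split; last first.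
  rewrite -ord_ge_nz //; apply: ord_geD; first by rewrite ord_ge_nz.
  by apply: ord_ge_le hy; rewrite lerDl.
rewrite leNgt; apply: contra nx1 => lt.
rewrite -[X in ord_ge _ _ X](addrK y); apply: ord_geB => //.
by rewrite ord_ge_nz // lezD1.
Qed.

(** At a pole the leading term dominates; in the Horner induction the constant [c] has order at
    least 0 and cannot cancel the rest. *)
Lemma ord_horner_pole P z (p : {poly F}) : z != 0 -> P z < 0 -> p != 0 ->
  ev z p != 0 /\ P (ev z p) = P z *+ (size p).-1.
Proof.
move=> z0 Pz; elim/poly_ind: p => [|p c IH]; first by rewrite eqxx.
rewrite rmorphD rmorphM /= map_polyX map_polyC hornerMXaddC size_MXaddC.
have [->|p0] := eqVneq p 0.
  rewrite rmorph0 horner0 mul0r !add0r mul0r add0r polyC_eq0 => c0.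
  by rewrite fmorph_eq0 (negPf c0) andbF ord_const // size_poly0 mulr0n.
have [e0 eE] := IH p0 => _; rewrite /=.
have ez0 : ev z p * z != 0 by rewrite mulf_neq0.
have Pez : P (ev z p * z) = P z *+ size p.
  by rewrite ordM // eE -mulrSr prednK // size_poly_gt0.
have [|-> ->] := @ordD_lt P (ev z p * z) (iota c) ez0; last by rewrite Pez.
apply: ord_ge_le (ord_ge_const P c); rewrite Pez -size_poly_gt0 in p0 *.
case: (size p) p0 => // n _; rewrite mulrS.
have : P z *+ n <= 0 by rewrite mulrn_wle0 // ltW.
by lia.
Qed.

(** By [ord_horner_pole] no nonzero polynomial vanishes at a function with a pole; a zero of [z] is
    a pole of its inverse. *)
Lemma ord_neq0_transcendental P z : z != 0 -> P z != 0 -> ~ algebraicOver iota z.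
Proof.
have pole u : u != 0 -> P u < 0 -> ~ algebraicOver iota u.
  move=> u0 Pu [p p0 /rootP r]; have [] := ord_horner_pole u0 Pu p0.
  by rewrite r eqxx.
move=> z0 Pz az; have := Pz; rewrite neq_lt => /orP[lt|gt].
  exact: pole z0 lt az.
apply: (pole z^-1); rewrite ?invr_eq0 ?ordV ?oppr_lt0 //.
exact: algebraic_inv.
Qed.

(** If [P z < k], every term on the right has order greater than that of [z ^+ m]. The weights
    [m - j] let one statement cover integrality ([k = 0]) and bounded poles ([k < 0]). *)
Lemma ord_ge_integral P (k : int) m z (b : 'I_m -> K) :
  z ^+ m = \sum_(j < m) b j * z ^+ j ->
  (forall j : 'I_m, ord_ge P (k *+ (m - j)) (b j)) -> ord_ge P k z.
Proof.
move=> zm hb; rewrite /ord_ge; case: eqVneq => //= z0; rewrite leNgt.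
apply/negP => zk; have zm0 : z ^+ m != 0 by rewrite expf_neq0.
suff : ord_ge P (P (z ^+ m) + 1) (z ^+ m) by rewrite ord_ge_nz // gerDl ler10.
rewrite {2}zm; apply: ord_ge_sum => j _.
have h : ord_ge P (P z *+ j) (z ^+ j) by rewrite ord_ge_nz ?expf_neq0 // ordX.
apply: ord_ge_le (ord_geM (hb j) h); rewrite ordX //.
have -> : P z *+ m = P z *+ (m - j) + P z *+ j by rewrite -mulrnDr subnK // ltnW.
rewrite addrAC lerD2r; have : (0 < m - j)%N by rewrite subn_gt0.
case: (m - j)%N => // n _.
by rewrite lezD1 ltrMn2r.
Qed.

(** Otherwise [0 <= Q u] always implies [0 <= P u], so units at [Q] are units at [P] and [P] is a
    multiple of [Q]. Both take the value 1, so the factor is 1. *)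
Lemma exists_separating P Q : ~ same_place P Q ->
  exists2 u, u != 0 & P u < 0 /\ 0 <= Q u.
Proof.
move=> nPQ; apply: contrapT => h; apply: nPQ.
have QP u : u != 0 -> 0 <= Q u -> 0 <= P u.
  move=> u0 Qu; rewrite leNgt; apply/negP => Pu; apply: h; by exists u.
have Q0 u : u != 0 -> Q u = 0 -> P u = 0.
  move=> u0 Qu; apply: le_anti; rewrite (QP u) ?Qu // andbT.
  by have := QP u^-1; rewrite invr_eq0 !ordV // Qu oppr0 oppr_ge0; apply.
have [pi pi0 Qpi] := ord_uniformizer Q.
have PE z : z != 0 -> P z = P pi * Q z.
  move=> z0; have pz0 : pi ^ (- Q z) != 0 by rewrite expfz_neq0.
  have := Q0 (z * pi ^ (- Q z)); rewrite mulf_neq0 // !ordM // !ordXz // Qpi.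
  rewrite mul1r subrr => /(_ isT erefl) /eqP.
  by rewrite mulrN subr_eq0 => /eqP.
have [rho rho0 Prho] := ord_uniformizer P.
have Ppi : P pi = 1.
  have := PE _ rho0; rewrite Prho; have := QP pi pi0; rewrite Qpi => /(_ isT).
  move=> Pp /(congr1 absz)/esym/eqP; rewrite abszM muln_eq1 => /andP[/eqP Pp1 _].
  by rewrite -(gez0_abs Pp) Pp1.
by move=> z z0; rewrite PE // Ppi mul1r.
Qed.

(** Induction on the number of places: [u] is right at all of them except possibly [P], and [v] is
    right at [Q] and [P]. A product of [v] with a function of [u] is right everywhere. *)
Lemma weak_approximation k (Ps : 'I_k -> place iota) Q :
  (forall i, ~ same_place Q (Ps i)) ->
  exists u, [/\ u != 0, Q u < 0 & forall i, 0 < Ps i u].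
Proof.
elim: k Ps => [|k IH] Ps nQ.
  have [pi pi0 Qpi] := ord_uniformizer Q; exists pi^-1.
  by rewrite invr_eq0 ordV // Qpi; split=> // -[].
have [u [u0 Qu Pu]] := IH (fun i => Ps (lift ord0 i)) (fun i => nQ _).
set P := Ps ord0.
(* A quotient of two separating functions, with poles at [Q] and at [P] respectively. *)
have [v [v0 Qv Pv]] : exists v, [/\ v != 0, Q v < 0 & 0 < P v].
  have [a a0 [Qa Pa]] := exists_separating (nQ ord0).
  have [|c c0 [Pc Qc]] := @exists_separating P Q.
    by move=> h; apply: (nQ ord0) => z z0; rewrite h.
  exists (a / c); rewrite mulf_neq0 ?invr_eq0 // !ordM ?invr_eq0 // !ordV //.
  split=> //; move: Qa Pa Pc Qc; move: (Q a) (Q c) (P a) (P c) => q1 q2 p1 p2; lia.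
have step w : w != 0 -> Q w < 0 -> 0 < P w ->
    (forall i, 0 < Ps (lift ord0 i) w) ->
    exists u, [/\ u != 0, Q u < 0 & forall i, 0 < Ps i u].
  move=> w0 Qw Pw h; exists w; split=> // i.
  by case: (unliftP ord0 i) => [j ->|->].
(* The zeros of [u ^+ N] at the remaining places outweigh the poles of [v] there. *)
have [N vN] : exists N : nat, forall i, 0 < Ps (lift ord0 i) v + N%:Z.
  exists (\max_i `|Ps (lift ord0 i) v|%N).+1 => i.
  have := leq_bigmax (F := fun i => `|Ps (lift ord0 i) v|%N) i.
  by move: (\max_i _)%N (Ps _ v) => a b; lia.
have uN0 : u ^+ N != 0 by rewrite expf_neq0.
(* If [P u = 0], take [u ^+ N * v]. If [P u < 0], replace the power by
   [u ^+ N.+1 / (1 + u ^+ N.+1)], which is a unit at the poles of [u] and keeps the zeros. If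
   [P u > 0], [u] already works. *)
have [lt|gt|eq] := ltgtP (P u) 0; last 1 first.
- apply: (step (u ^+ N * v)); rewrite ?mulf_neq0 // ?ordM // ?ordX //.
  + by rewrite -mulr_natr; nia.
  + by rewrite eq mul0rn add0r.
  + by move=> i; rewrite ordM // ordX //; have := Pu i; have := vN i;
       rewrite -mulr_natr; nia.
- have u1 (R : place iota) : 0 < R u -> 1 + u ^+ N.+1 != 0 /\ R (1 + u ^+ N.+1) = 0.
    move=> Ru; have := @ordD_lt R 1 (u ^+ N.+1) (oner_neq0 _); rewrite ord1; apply.
    by rewrite ord_ge_nz ?expf_neq0 // ordX // -mulr_natr; nia.
  have u2 (R : place iota) : R u < 0 ->
      1 + u ^+ N.+1 != 0 /\ R (1 + u ^+ N.+1) = R u *+ N.+1.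
    move=> Ru; rewrite addrC; have uN1 : u ^+ N.+1 != 0 by rewrite expf_neq0.
    have := @ordD_lt R (u ^+ N.+1) 1 uN1; rewrite ordX //; apply.
    by rewrite ord_ge_nz ?oner_neq0 // ord1 -mulr_natr; nia.
  have [n1 Q1] := u2 _ Qu; have [_ P1] := u2 _ lt.
  have uN1 : u ^+ N.+1 != 0 by rewrite expf_neq0.
  have i1 : (1 + u ^+ N.+1)^-1 != 0 by rewrite invr_eq0.
  have R1 (R : place iota) : R (u ^+ N.+1 / (1 + u ^+ N.+1) * v) =
      R u *+ N.+1 - R (1 + u ^+ N.+1) + R v.
    by rewrite !ordM ?mulf_neq0 // ordX // ordV.
  apply: (step (u ^+ N.+1 / (1 + u ^+ N.+1) * v)); rewrite ?mulf_neq0 // ?R1.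
  + by rewrite Q1 subrr add0r.
  + by rewrite P1 subrr add0r.
  + move=> i; rewrite R1; have [_ ->] := u1 _ (Pu i); rewrite subr0.
    by have := Pu i; have := vN i; rewrite -mulr_natr; nia.
- exact: step u0 Qu gt Pu.
Qed.

End Places.

(** * Functions with a single pole *)

Section PolyIndependence.
Variables (F K : fieldType) (iota : {rmorphism F -> K}).
Implicit Types (x y z u : K).

Definition evp z (p : {poly F}) : K := (map_poly iota p).[z].

Lemma evpE z p : evp z p = (map_poly iota p).[z].
Proof. by []. Qed.

Lemma evp0 z : evp z 0 = 0.
Proof. by rewrite /evp rmorph0 horner0. Qed.

Lemma evpD z p q : evp z (p + q) = evp z p + evp z q.
Proof. by rewrite /evp rmorphD hornerD. Qed.

Lemma evpN z p : evp z (- p) = - evp z p.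
Proof. by rewrite /evp rmorphN hornerN. Qed.

Lemma evpXn z p n : evp z (p ^+ n) = evp z p ^+ n.
Proof. by rewrite /evp rmorphXn horner_exp. Qed.

Lemma evpM z p q : evp z (p * q) = evp z p * evp z q.
Proof. by rewrite /evp rmorphM hornerM. Qed.

Lemma evp_sum z (I : finType) (p : I -> {poly F}) :
  evp z (\sum_i p i) = \sum_i evp z (p i).
Proof. by rewrite /evp rmorph_sum horner_sum. Qed.

Lemma evp_prod z (I : finType) (p : I -> {poly F}) :
  evp z (\prod_i p i) = \prod_i evp z (p i).
Proof. by rewrite /evp rmorph_prod horner_prod. Qed.

Lemma evpC z c : evp z c%:P = iota c.
Proof. by rewrite evpE map_polyC hornerC. Qed.

Lemma evpX z : evp z 'X = z.
Proof. by rewrite evpE map_polyX hornerX. Qed.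

Lemma evp_wide z (p : {poly F}) N : (size p <= N)%N ->
  evp z p = \sum_(j < N) iota p`_j * z ^+ j.
Proof.
move=> pN; rewrite evpE (@horner_coef_wide _ N) ?size_map_poly //.
by apply: eq_bigr => j _; rewrite coef_map.
Qed.

Lemma evp_neq0 z p : ~ algebraicOver iota z -> p != 0 -> evp z p != 0.
Proof. by move=> za p0; apply/eqP => h; apply: za; exists p => //; apply/rootP. Qed.

(** For transcendental [z] this is linear independence over the field [F(z)], with denominators
    cleared. *)
Definition poly_indep z k (w : 'I_k -> K) : Prop :=
  forall p : 'I_k -> {poly F}, \sum_i evp z (p i) * w i = 0 -> forall i, p i = 0.

Lemma poly_dep z k (w : 'I_k -> K) : ~ poly_indep z w ->
  exists2 p : 'I_k -> {poly F}, \sum_i evp z (p i) * w i = 0 & exists i, p i != 0.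
Proof.
move=> /existsNP[p /not_implyP[h /existsNP[i /eqP pi]]].
by exists p => //; exists i.
Qed.

(** Reversing the coefficients of [p i] turns a relation over [F[1/z]] into one over [F[z]]. Rank
    bounds thus pass between a uniformizer and its inverse. *)
Lemma poly_indep_inv z k (w : 'I_k -> K) : z != 0 ->
  poly_indep z w -> poly_indep z^-1 w.
Proof.
move=> z0 wI p pw; pose N := \max_i size (p i).
have pN i : (size (p i) <= N)%N by exact: leq_bigmax.
pose r i : {poly F} := \poly_(j < N) (p i)`_(N - j.+1).
have rE i : evp z (r i) = z ^+ N.-1 * evp z^-1 (p i).
  rewrite (evp_wide _ (size_poly _ _)) (evp_wide _ (pN i)) mulr_sumr.
  rewrite (reindex_inj rev_ord_inj); apply: eq_bigr => j _ /=.
  rewrite coef_poly ltn_subrL /=.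
  have N0 : (0 < N)%N by apply: leq_ltn_trans (ltn_ord j).
  rewrite N0 mulrCA; congr (iota _ * _).
    by congr (_`_ _); have := ltn_ord j; lia.
  rewrite exprVn -[X in z ^+ X](_ : (N.-1 - j)%N = _); last by lia.
  by rewrite expfB_cond // (negPf z0) /= add0n; have := ltn_ord j; lia.
move=> i; apply/polyP => j; rewrite coef0.
have [jN|Nj] := ltnP j N; last by rewrite nth_default //; apply: leq_trans (pN i) Nj.
have /(congr1 (fun q : {poly F} => q`_(N - j.+1))) : r i = 0.
  apply: (wI r); transitivity (z ^+ N.-1 * 0); last exact: mulr0.
  rewrite -{}[in RHS]pw mulr_sumr.
  by apply: eq_bigr => l _; rewrite rE mulrA.
rewrite coef_poly coef0 ltn_subrL (leq_ltn_trans _ jN) //=.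
by have -> : (N - (N - j.+1).+1)%N = j by lia.
Qed.

Lemma growth_dependence_field y k a b (w : 'I_k -> K) : (a < k)%N ->
  (forall s, exists (J : finType) (g : J -> K), (#|J| <= b + a * s)%N /\
     forall i j, (j <= s)%N ->
       exists c : J -> F, y ^+ j * w i = \sum_l iota (c l) * g l) ->
  ~ poly_indep y w.
Proof.
move=> ak gen wI.
have [p [[i pi] h]] :=
  @growth_dependence F (restr iota K^o) k a b (fun i j => y ^+ j * w i) ak gen.
case/eqP: pi; apply: wI; apply: etrans h; apply: eq_bigr => j _.
rewrite (evp_wide _ (leqnn _)) mulr_suml; apply: eq_bigr => l _.
by rewrite -mulrA.
Qed.

Lemma common_denominator n (e : 'I_n -> K) x (I : finType) (z : I -> K) :
  (forall y : K, exists p q : 'I_n -> {poly F},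
     (forall i, (map_poly iota (q i)).[x] != 0) /\
     y = \sum_i (map_poly iota (p i)).[x] / (map_poly iota (q i)).[x] * e i) ->
  exists (q : {poly F}) (p : I -> 'I_n -> {poly F}), evp x q != 0 /\
    forall i, evp x q * z i = \sum_j evp x (p i j) * e j.
Proof.
move=> span; have [P PE] := choice (fun i => span (z i)).
have [Q QE] := choice PE.
pose q := \prod_i \prod_j Q i j.
have dvd i j : exists h, q = h * Q i j.
  rewrite /q (bigD1 i) //= (bigD1 j) //=.
  by eexists; rewrite -mulrA mulrC.
have [H HE] := choice (fun ij : I * 'I_n => dvd ij.1 ij.2).
exists q, (fun i j => H (i, j) * P i j); split.
  rewrite /q evp_prod; apply/prodf_neq0 => i _.
  by rewrite evp_prod; apply/prodf_neq0 => j _; apply: (proj1 (QE i)).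
move=> i; have [Q0 ->] := QE i; rewrite mulr_sumr; apply: eq_bigr => j _.
have /= qE := HE (i, j); rewrite qE !evpM -!evpE.
have : evp x (Q i j) != 0 by exact: Q0.
move: (evp x (Q i j)) (evp x (H _)) (evp x (P i j)) => a b c a0.
by field.
Qed.

(** This bounds the degree of [K] over [F(y)]. Up to a common denominator, the [y ^+ j * w i] with
    [j <= s] have coordinates in [F[x]] of size at most [D0 + s D] on the [n] generators, so the
    dimension grows with slope [n D]. *)
Lemma function_field_rank y : is_function_field iota ->
  exists B, forall k (w : 'I_k -> K), poly_indep y w -> (k <= B)%N.
Proof.
move=> [x [_ [n [e span]]]].
have [q [m [q0 mE]]] := common_denominator (fun i => y * e i) span.
(* Multiplication by [q] or by [q y] raises the sizes of the coordinates by at most [D]. Both are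
   needed, so that all [j <= s] share the denominator [q ^+ s]. *)
pose D := maxn (size q) (\max_(ij : 'I_n * 'I_n) size (m ij.1 ij.2)).
exists (n * D)%N => k w wI; rewrite leqNgt; apply/negP => kD; move: wI.
have [r [l [r0 lE]]] := common_denominator w span.
pose D0 := \max_(ij : 'I_k * 'I_n) size (l ij.1 ij.2).
pose E N z := exists2 p : 'I_n -> {poly F},
  (forall j, (size (p j) <= N)%N) & z = \sum_j evp x (p j) * e j.
have Eq N z : E N z -> E (N + D)%N (evp x q * z).
  move=> [p pN ->]; exists (fun j => q * p j).
    move=> j; apply: leq_trans (size_polyMleq _ _) _.
    apply: leq_trans (leq_pred _) _; rewrite addnC leq_add //.
    exact: leq_maxl.
  by rewrite mulr_sumr; apply: eq_bigr => j _; rewrite evpM mulrA.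
have Ey N z : E N z -> E (N + D)%N (evp x q * (y * z)).
  move=> [p pN ->]; exists (fun j => \sum_i p i * m i j).
    move=> j; apply: leq_trans (size_sum _ _ _) _; apply/bigmax_leqP => i _.
    apply: leq_trans (size_polyMleq _ _) _.
    apply: leq_trans (leq_pred _) _; rewrite leq_add //.
    apply: leq_trans (leq_maxr _ _).
    exact: (leq_bigmax (F := fun ij : 'I_n * 'I_n => size (m ij.1 ij.2)) (i, j)).
  transitivity (\sum_i evp x (p i) * (evp x q * (y * e i))).
    rewrite !mulr_sumr; apply: eq_bigr => i _.
    by rewrite [y * _]mulrCA [evp x q * _]mulrCA.
  under eq_bigr => i _ do rewrite mE mulr_sumr.
  rewrite exchange_big; apply: eq_bigr => j _ /=.
  rewrite evp_sum mulr_suml; apply: eq_bigr => i _.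
  by rewrite evpM mulrA.
have Es s i j : (j <= s)%N ->
    E (D0 + s * D)%N (evp x r * evp x q ^+ s * (y ^+ j * w i)).
  elim: s j => [|s IH] j js.
    have -> : j = 0%N by case: j js.
    rewrite !expr0 mulr1 mul1r mul0n addn0 lE; exists (l i) => // j'.
    exact: (leq_bigmax (F := fun ij : 'I_k * 'I_n => size (l ij.1 ij.2)) (i, j')).
  rewrite mulSn [(D + _)%N]addnC addnA.
  case: j js => [|j] js.
    have := Eq _ _ (IH 0%N isT); congr E.
    by rewrite exprS; ring.
  have := Ey _ _ (IH j js); congr E.
  by rewrite !exprS; ring.
apply: (@growth_dependence_field y k (n * D) (n * D0)) => // s.
(* The common denominator depends on [s] and is absorbed into the generators. *)
have rq0 : evp x r * evp x q ^+ s != 0 by rewrite mulf_neq0 ?expf_neq0.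
exists ('I_(D0 + s * D) * 'I_n)%type,
  (fun lj : 'I_(D0 + s * D) * 'I_n => x ^+ lj.1 * e lj.2 / (evp x r * evp x q ^+ s)).
rewrite card_prod !card_ord; split=> [|i j js]; first by nia.
have [p ps h] := Es s i j js;
  exists (fun lj : 'I_(D0 + s * D) * 'I_n => (p lj.2)`_(lj.1)).
rewrite -[LHS](mulKf rq0) h mulrC mulr_suml.
transitivity (\sum_(l' < D0 + s * D) \sum_j' iota (p j')`_l' *
    (x ^+ l' * e j' / (evp x r * evp x q ^+ s))); last first.
  by rewrite pair_bigA; apply: eq_bigr => -[].
rewrite exchange_big; apply: eq_bigr => j' _ /=.
rewrite (evp_wide _ (ps j')) !mulr_suml; apply: eq_bigr => l' _.
by rewrite !mulrA.
Qed.

End PolyIndependence.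

(** * Functions regular above the zeros of a uniformizer *)

Section RegularFunctions.
Variables (F K : fieldType) (iota : {rmorphism F -> K}).
Implicit Types (P Q : place iota) (x y z u : K) (p : {poly F}).
Local Notation evp := (evp iota).
Local Notation poly_indep := (poly_indep iota).

Lemma evp_split z p : evp z p = iota p`_0 + z * evp z (drop_poly 1 p).
Proof.
have pE : p = (p`_0)%:P + drop_poly 1 p * 'X.
  rewrite -[LHS](poly_take_drop 1) expr1; congr (_ + _).
  by apply/polyP => -[|j]; rewrite coef_take_poly coefC.
by rewrite [in LHS]pE evpD evpM evpC evpX mulrC.
Qed.

Lemma ord_ge_evp P z p : ord_ge P 0 z -> ord_ge P 0 (evp z p).
Proof.
move=> Pz; rewrite (evp_wide iota _ (leqnn _)); apply: ord_ge_sum => i _.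
by apply: ord_ge_constM; have := ord_geX i Pz; rewrite mul0rn.
Qed.

Lemma ord_ge_evp_inv P x p N : x != 0 -> 0 < P x -> (size p <= N)%N ->
  ord_ge P (- (P x *+ N)) (evp x^-1 p).
Proof.
move=> x0 Px pN; rewrite (evp_wide iota _ pN); apply: ord_ge_sum => i _.
apply: ord_ge_constM; rewrite ord_ge_nz ?expf_neq0 ?invr_eq0 //.
rewrite ordX ?invr_eq0 // ordV // mulNrn lerN2.
by apply: ler_wpMn2l; [exact: ltW|exact: ltnW].
Qed.

(** A relation whose constant terms all vanish can be divided by [x]; repeating this lowers the
    sizes to 0. Independence modulo [x] thus gives independence over [F[x]]. *)
Lemma poly_indep_const_term x k (b : 'I_k -> K) : x != 0 ->
  (forall p : 'I_k -> {poly F}, \sum_i evp x (p i) * b i = 0 ->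
     forall i, (p i)`_0 = 0) -> poly_indep x b.
Proof.
move=> x0 h p pb.
suff key N : forall q : 'I_k -> {poly F}, (forall i, (size (q i) <= N)%N) ->
    \sum_i evp x (q i) * b i = 0 -> forall i, q i = 0.
  apply: (key (\max_i size (p i))) pb => i.
  exact: (leq_bigmax (F := fun i => size (p i))).
elim: N => [|N IH] q qN qb i.
  by apply/eqP; rewrite -size_poly_eq0 -leqn0.
have q0 := h q qb.
have dq0 : forall i, drop_poly 1 (q i) = 0.
  apply: IH => [j|]; first by rewrite size_drop_poly leq_subLR add1n.
  apply: (mulfI x0); rewrite mulr0 mulr_sumr; apply: etrans qb.
  by apply: eq_bigr => j _; rewrite [in RHS]evp_split q0 rmorph0 add0r mulrA.
rewrite -[LHS](poly_take_drop 1) dq0 mul0r addr0.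
by apply/polyP => -[|j]; rewrite coef_take_poly coef0 //= q0.
Qed.

Variable ffK : is_function_field iota.
Variable oo : place iota.

Section Uniformizer.
Variables (x : K).
Hypotheses (x0 : x != 0) (oox : oo x = 1).
Let y := x^-1.
Let y0 : y != 0. Proof. by rewrite invr_eq0. Qed.
Let y_tr : ~ algebraicOver iota y.
Proof. by apply: (@ord_neq0_transcendental _ _ _ oo); rewrite // ordV // oox. Qed.

Variables (n : nat).
Hypothesis rank_le : forall k (w : 'I_k -> K), poly_indep y w -> (k <= n)%N.

Let rank_le_inv k (w : 'I_k -> K) : poly_indep x w -> (k <= n)%N.
Proof. by move=> wI; apply: (rank_le (w := w)); apply: poly_indep_inv. Qed.

(** Weak approximation gives [u i] with a pole at [Ps i] and zeros at the other places. They are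
    independent over [F[x]]: if [p i] has a nonzero constant term, its term alone has a pole at
    [Ps i]. *)
Lemma separated_places k (Ps : 'I_k -> place iota) :
  (forall i, 0 < Ps i x) -> (forall i j, i != j -> ~ same_place (Ps i) (Ps j)) ->
  (k <= n)%N.
Proof.
case: k Ps => // k Ps Px nP.
have wa i : exists u, [/\ u != 0, Ps i u < 0 & forall j, j != i -> 0 < Ps j u].
  have [|u [u0 Pu Pju]] := @weak_approximation _ _ _ k (fun j => Ps (lift i j)) (Ps i).
    by move=> j; apply: nP; rewrite neq_lift.
  exists u; split=> // j; case: (unliftP i j) => [l -> _|->]; first exact: Pju.
  by rewrite eqxx.
have [u uP] := choice wa.
apply: (rank_le_inv (w := u)); apply: poly_indep_const_term => // p pu i.
apply/eqP; apply: contrapT => /negP pi0.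
have Pxi : ord_ge (Ps i) 0 x by rewrite ord_ge_nz // ltW.
have [e0 Pe] : evp x (p i) != 0 /\ Ps i (evp x (p i)) = 0.
  have i0 : iota (p i)`_0 != 0 by rewrite fmorph_eq0.
  have := @ordD_lt _ _ _ (Ps i) _ (x * evp x (drop_poly 1 (p i))) i0.
  rewrite -evp_split ord_const // => h.
  apply: h; rewrite addrC; apply: ord_geM; last exact: ord_ge_evp.
  by rewrite ord_ge_nz // -gtz0_ge1 Px.
have [ui0 Pui Pu] := uP i.
have eu0 : evp x (p i) * u i != 0 by rewrite mulf_neq0.
have [|] := @ordD_lt _ _ _ (Ps i) _ (\sum_(j | j != i) evp x (p j) * u j) eu0.
  rewrite ordM // Pe add0r; apply: ord_ge_sum => j ji.
  rewrite -[_ + 1]add0r; apply: ord_geM; first exact: ord_ge_evp.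
  have [uj0 _ Pj] := uP j; rewrite ord_ge_nz // lezD1.
  by apply: lt_trans Pui _; apply: Pj; rewrite eq_sym.
have := pu; rewrite (bigD1 i) //= => ->; by rewrite eqxx.
Qed.

(** By [separated_places] the zeros of [x] other than [oo] have a maximal finite family. Let [u]
    vanish on it and have a pole at [oo]; a further pole of [u] among the zeros of [x] would enlarge
    the family. *)
Lemma exists_pole_only_at : exists u, [/\ u != 0, oo u < 0 &
  forall P, 0 < P x -> ~ same_place P oo -> ord_ge P 0 u].
Proof.
have [||k [Ps [[Px Poo nP] kmax]]] := @max_family (place iota)
  (fun k Ps => [/\ forall i : 'I_k, 0 < Ps i x, forall i, ~ same_place oo (Ps i) &
     forall i j, i != j -> ~ same_place (Ps i) (Ps j)]) n.
- by exists (fun=> oo); split=> -[].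
- by move=> k Ps [Px _ nP]; apply: separated_places nP.
have [u [u0 oou Pu]] := weak_approximation Poo.
exists u; split=> // P Px0 Pnoo; apply: contrapT => /negP nPu.
have nPs i : ~ same_place (Ps i) P.
  move=> e; move: nPu; rewrite ord_ge_nz // -e //.
  by rewrite ltW.
have := kmax k.+1 (ocons P Ps); rewrite ltnn => h; suff : false by [].
apply: h; split=> [i|i|i j].
- by case: (unliftP ord0 i) => [l ->|->]; rewrite ?oconsS ?ocons0.
- case: (unliftP ord0 i) => [l ->|->]; rewrite ?oconsS ?ocons0 //.
  by move=> e; apply: Pnoo => z z0; rewrite e.
- case: (unliftP ord0 i) => [l ->|->]; case: (unliftP ord0 j) => [l' ->|->];
    rewrite ?oconsS ?ocons0 ?eqxx //.
  + by rewrite (inj_eq (@lift_inj _ ord0)); apply: nP.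
  + by move=> _ e; apply: (nPs l') => z z0; rewrite e.
Qed.

Definition regular_above z : Prop := forall P, 0 < P x -> ord_ge P 0 z.
Local Notation R := regular_above.

Lemma regular_aboveM z z' : R z -> R z' -> R (z * z').
Proof. by move=> h h' P Px; rewrite -[0]addr0; apply: ord_geM; [apply: h|apply: h']. Qed.
Lemma regular_aboveD z z' : R z -> R z' -> R (z + z').
Proof. by move=> h h' P Px; apply: ord_geD; [apply: h|apply: h']. Qed.
Lemma regular_aboveN z : R z -> R (- z).
Proof. by move=> h P Px; apply: ord_geN; apply: h. Qed.
Lemma regular_above_const c : R (iota c).
Proof. by move=> P _; apply: ord_ge_const. Qed.
Lemma regular_above_x : R x.
Proof. by move=> P Px; rewrite ord_ge_nz // ltW. Qed.
Lemma regular_above_sum (I : finType) (f : I -> K) :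
  (forall i, R (f i)) -> R (\sum_i f i).
Proof. by move=> h P Px; apply: ord_ge_sum => i _; apply: h. Qed.

(** This bounds the dimension of [R / x R] by [n]: a family independent modulo [x R] is independent
    over [F[x]] by [poly_indep_const_term], and a maximal one spans. *)
Lemma regular_above_span : exists m (b : 'I_m -> K),
  [/\ (m <= n)%N, forall i, R (b i) & forall z, R z -> exists (c : 'I_m -> F) r,
    R r /\ z = \sum_i iota (c i) * b i + x * r].
Proof.
have indep_le k (b : 'I_k -> K) : (forall i, R (b i)) ->
    (forall c r, R r -> \sum_i iota (c i) * b i = x * r -> forall i, c i = 0) ->
    (k <= n)%N.
  move=> bR bI; apply: (rank_le_inv (w := b)).
apply: poly_indep_const_term => // p pb.
  (* The terms of the relation divisible by [x], moved to the other side; what remains are the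
     constant terms. *)
  pose r := - \sum_i evp x (drop_poly 1 (p i)) * b i.
  apply: (bI _ r).
    apply/regular_aboveN/regular_above_sum => i; apply: regular_aboveM => // P Px.
    by apply: ord_ge_evp; apply: regular_above_x.
  apply/eqP; rewrite -subr_eq0 mulrN opprK -[X in _ == X]pb mulr_sumr -big_split.
  by apply/eqP/eq_bigr => i _; rewrite [in RHS]evp_split mulrDl mulrA.
have [||m [b [[bR bI] mmax]]] := @max_family K
  (fun k b => (forall i : 'I_k, R (b i)) /\
     forall c r, R r -> \sum_i iota (c i) * b i = x * r -> forall i, c i = 0) n.
- by exists (fun=> 0); split=> [[]|c r _ _ []].
- by move=> k b []; apply: indep_le.
exists m, b; split=> // [|z zR]; first exact: indep_le bI.
have : ~ ((forall i, R (ocons z b i)) /\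
     forall c r, R r -> \sum_i iota (c i) * ocons z b i = x * r -> forall i, c i = 0).
  by move=> /mmax; rewrite ltnn.
move=> /not_andP[h|].
  by case: h => i; case: (unliftP ord0 i) => [l ->|->]; rewrite ?oconsS ?ocons0.
move=> /existsNP[c /existsNP[r /not_implyP[rR /not_implyP[]]]].
rewrite big_ord_recl ocons0; under eq_bigr => i _ do rewrite oconsS.
move=> cr cn0; have c0 : c ord0 != 0.
  apply/eqP => c0; apply: cn0 => i; case: (unliftP ord0 i) => [j ->|-> //].
  apply: (bI (fun j => c (lift ord0 j)) r) => //.
  by rewrite -cr c0 rmorph0 mul0r add0r.
exists (fun i => - (c ord0)^-1 * c (lift ord0 i)), (iota (c ord0)^-1 * r).
split; first by apply: regular_aboveM => //; apply: regular_above_const.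
have ic0 : iota (c ord0) != 0 by rewrite fmorph_eq0.
apply: (mulfI ic0); rewrite mulrDr mulr_sumr.
rewrite [iota _ * (x * _)]mulrCA [iota _ * (iota _ * r)]mulrA -rmorphM mulfV //.
rewrite rmorph1 mul1r -cr [RHS]addrCA -[LHS]addr0; congr (_ + _).
rewrite -big_split /= big1 // => i _.
rewrite mulrA -rmorphM mulNr mulrN mulrA mulfV // mul1r rmorphN mulNr addNr //.
Qed.

(** Expanding the remainder again and again gives [x]-adic expansions, so [R] modulo [x ^+ N] has
    dimension at most [n N]. *)
Lemma regular_above_span_pow : exists m (b : 'I_m -> K), (m <= n)%N /\
  forall N z, R z -> exists (c : 'I_N * 'I_m -> F) r,
    R r /\ z = \sum_l iota (c l) * (x ^+ l.1 * b l.2) + x ^+ N * r.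
Proof.
have [m [b [mn bR span]]] := regular_above_span; exists m, b; split=> // N z zR.
suff [c [r [rR ->]]] : exists (c : nat -> 'I_m -> F) r,
    R r /\ z = \sum_(j < N) \sum_i iota (c j i) * (x ^+ j * b i) + x ^+ N * r.
  exists (fun l : 'I_N * 'I_m => c l.1 l.2), r; split=> //; congr (_ + _).
  by rewrite pair_bigA.
elim: N => [|N [c [r [rR zE]]]].
  by exists (fun _ _ => 0), z; split; rewrite // big_ord0 add0r mul1r.
have [c' [r' [rR' rE]]] := span r rR.
exists (fun j => if j == N then c' else c j), r'; split=> //.
rewrite zE big_ord_recr /= eqxx -addrA; congr (_ + _).
  by apply: eq_bigr => j _; rewrite ltn_eqF.
rewrite {1}rE mulrDr mulr_sumr exprSr mulrA; congr (_ + _).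
by apply: eq_bigr => i _; rewrite mulrCA.
Qed.

(** The powers of [z] up to [n] are dependent over [F[y]]. Multiplied by the leading coefficient [a]
    of a relation, [z] becomes integral over [F[y]], and [ord_ge_integral] bounds it at the poles of
    [y] as well. *)
Lemma integral_multiple z : exists (a : {poly F}) (c : nat), a != 0 /\
  forall P, (0 <= P y -> ord_ge P 0 (evp y a * z)) /\
    (0 < P x -> ord_ge P (- (P x *+ c)) (evp y a * z)).
Proof.
have : ~ poly_indep y (fun j : 'I_n.+1 => z ^+ j).
  by move=> /rank_le; rewrite ltnn.
move=> /poly_dep[p pz [i0 pi0]].
case: (@arg_maxnP _ i0 (fun j => p j != 0) val pi0) => m pm0 mmax.
pose a := p m; pose Z := evp y a * z.
have ea0 : evp y a != 0 by exact: evp_neq0.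
have m0 : (0 < m)%N.
  rewrite lt0n; apply/negP => /eqP m0; move: pz.
  rewrite (bigD1 m) //= m0 mulr1 big1 ?addr0 => [/eqP|j jm]; first by rewrite (negPf ea0).
  have -> : p j = 0; last by rewrite evp0 mul0r.
  apply/eqP; apply: contraNT jm => /mmax /=; rewrite m0 leqn0 => /eqP j0.
  by apply/eqP/val_inj; rewrite /= j0 m0.
pose B (j : 'I_m) := - (p (widen_ord (ltnW (ltn_ord m)) j) * a ^+ (m - j.+1)).
have ZE : Z ^+ m = \sum_(j < m) evp y (B j) * Z ^+ j.
  have hi : \sum_(j < m.+1) evp y (p (inord j)) * z ^+ j = 0.
    rewrite -[RHS]pz [RHS](bigID (fun j : 'I_n.+1 => (j < m.+1)%N)) /=.
    rewrite [X in _ + X]big1 ?addr0 => [|j]; last first.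
      rewrite -ltnNge => jm; suff -> : p j = 0 by rewrite evp0 mul0r.
      by apply/eqP; apply: contraTT jm => /mmax; rewrite -leqNgt.
    rewrite (big_ord_widen _ (fun j => evp y (p (inord j)) * z ^+ j) (ltn_ord m)).
    by apply: eq_bigr => j _; rewrite inord_val.
  move: hi; rewrite big_ord_recr /= inord_val -/a => /eqP.
  rewrite addrC addr_eq0 => /eqP am.
  rewrite /Z exprMn -[in LHS](prednK m0) [evp y a ^+ _]exprSr -mulrA (prednK m0) am.
  rewrite mulrN mulr_sumr -sumrN; apply: eq_bigr => j _.
  have -> : evp y (B j) = - (evp y (p (inord j)) * evp y a ^+ (m - j.+1)).
    rewrite /B evpN evpM evpXn; congr (- (evp y (p _) * _)).
    by apply: val_inj; rewrite /= inordK //; have := ltn_ord j; have := ltn_ord m; lia.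
  rewrite exprMn mulNr; congr (- _).
  have -> : m.-1 = (m - j.+1 + j)%N by have := ltn_ord j; lia.
  by rewrite exprD; ring.
exists a, (\max_j size (B j)); split=> // P; split=> [Py|Px].
  apply: (ord_ge_integral ZE) => j; rewrite mul0rn; apply: ord_ge_evp.
  by rewrite ord_ge_nz.
apply: (ord_ge_integral ZE) => j.
apply: ord_ge_le (ord_ge_evp_inv x0 Px (leqnn (size (B j)))).
rewrite mulNrn lerN2 -mulrnA; apply: ler_wpMn2l; first exact: ltW.
have cB : (size (B j) <= \max_j size (B j))%N.
  exact: (leq_bigmax (F := fun j => size (B j))).
by apply: leq_trans cB _; rewrite leq_pmulr // subn_gt0.
Qed.

End Uniformizer.

Theorem exists_transcendental_regular : exists z,
  ~ algebraicOver iota z /\ forall P, ~ same_place P oo -> ord_ge P 0 z.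
Proof.
have [x x0 oox] := ord_uniformizer oo; pose y := x^-1.
have y0 : y != 0 by rewrite invr_eq0.
have [B rB] := function_field_rank y ffK.
have [|n [w [wI rank_le]]] := max_family (Q := fun k w => @poly_indep y k w) _ rB.
  by exists (fun=> 0) => p _ [].
have [u [u0 oou Pu]] := exists_pole_only_at x0 rank_le.
have [m [b [mn span]]] := regular_above_span_pow x0 rank_le.
have [a aP] := choice (fun i => integral_multiple x0 oox rank_le (w i)).
have [c cP] := choice aP.
(* The [W i] are the integral basis; at a zero [P] of [x] their poles have order at most [C] times
   [P x]. *)
pose C := \max_i c i; pose W i := evp y (a i) * w i.
have WI : poly_indep y W.
  move=> p pW i; have [ai0 _] := cP i.
  suff h : p i * a i = 0.
    by apply/eqP; have /eqP := h; rewrite mulf_eq0 (negPf ai0) orbF.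
  apply: (wI (fun i => p i * a i)); apply: etrans pW; apply: eq_bigr => j _.
  by rewrite evpM mulrA.
have Wy P i : 0 <= P y -> ord_ge P 0 (W i) 
  by move=> Py; have [_ /(_ P)[h _]] := cP i; apply: h.
have Wx P i : 0 < P x -> ord_ge P (- (P x *+ C)) (W i).
  move=> Px; have [_ /(_ P)[_ /(_ Px)]] := cP i; apply: ord_ge_le.
  rewrite lerN2; apply: ler_wpMn2l; first exact: ltW.
  exact: (leq_bigmax (F := c)).
(* With [N = s + C], the number [n (s + 1) + kap] of functions exceeds [n (N + 1)] by exactly
   one. *)
pose kap := (n * C).+1; pose e := `|oo u|%N.
have eE : oo u = - e%:Z by rewrite /e ltz0_abs // opprK.
(* The factor [x ^+ s] cancels the poles at [oo] of the powers of [u], of order at most [kap e]; the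
   further [C] cancels those of the [W i]. *)
pose s := (kap * e)%N; pose N := (s + C)%N.
pose v (i : ('I_n * 'I_s.+1) + 'I_kap) : K :=
  match i with inl ij => y ^+ ij.2 * W ij.1 | inr k => u ^+ k.+1 end.
have PuN P k : 0 < P x -> ~ same_place P oo -> ord_ge P 0 (u ^+ k).
  by move=> Px nP; have := ord_geX k (Pu P Px nP); rewrite mul0rn.
have vR i : regular_above x (x ^+ N * v i).
  move=> P Px; have xN : ord_ge P (P x *+ N) (x ^+ N).
    by apply: ord_geX; rewrite ord_ge_nz.
  case: i => [[i j]|k] /=.
    have yj : ord_ge P (- (P x *+ j)) (y ^+ j).
      by rewrite -mulNrn; apply: ord_geX; rewrite ord_ge_nz // ordV.
    apply: ord_ge_le (ord_geM xN (ord_geM yj (Wx P i Px))).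
    rewrite -opprD -mulrnDr subr_ge0; apply: ler_wpMn2l; first exact: ltW.
    by rewrite leq_add2r -ltnS.
  have [Poo|nPoo] := pselect (same_place P oo).
    rewrite ord_ge_nz ?mulf_neq0 ?expf_neq0 // ordM ?expf_neq0 // !ordX //.
    rewrite !Poo // oox eE mulNrn subr_ge0 !pmulrn !mulrzz mul1r.
    rewrite -PoszM lez_nat mulnC.
    apply: leq_trans (leq_addr _ _); exact: leq_mul.
  apply: ord_ge_le (ord_geM xN (PuN P k.+1 Px nPoo)).
  by rewrite addr0 mulrn_wge0 // ltW.
pose U (z : restr iota K^o) := exists2 r, regular_above x r & z = x ^+ N.+1 * r :> K.
have [||i|d [[i0 d0] [r rR dE]]] := @pigeonhole_mod F (restr iota K^o) U
    _ ('I_N.+1 * 'I_m)%type (fun i => x ^+ N * v i) (fun l => x ^+ l.1 * b l.2).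
- split=> [|f z z' [r rR ->] [r' rR' ->]].
    exists 0; last by rewrite mulr0.
    by rewrite -(rmorph0 iota); apply: regular_above_const.
  exists (iota f * r + r').
    apply: regular_aboveD => //; apply: regular_aboveM => //.
    exact: regular_above_const.
  by rewrite mulrDr mulrCA.
- rewrite card_sum !card_prod !card_ord /N /kap.
  have := leq_mul (leqnn (s + C).+1) mn; nia.
- have [c' [r [rR ->]]] := span N.+1 _ (vR i); exists c', r => //.
  by apply: (canLR (addrK _)); rewrite addrC.
have dE' : \sum_i iota (d i) * v i = x * r.
  have xN0 : x ^+ N != 0 by rewrite expf_neq0.
  apply: (mulfI xN0); rewrite mulrA -exprSr -[RHS]dE mulr_sumr.
  by apply: eq_bigr => i _; rewrite mulrCA.
move: dE'; rewrite big_sumType /=.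
set z := \sum_i _; set t := \sum_i _ => ztr.
have xr1 : ord_ge oo 1 (x * r).
  rewrite -[1]addr0; apply: ord_geM; first by rewrite ord_ge_nz // oox.
  by apply: rR; rewrite oox.
have zE : z = - t + x * r by rewrite -ztr addrCA addNr addr0.
(* Where [y] is regular, so is each [y ^+ j * W i]. The other places are zeros of [x]; there
   [z = - t + x * r] is regular because [u] has its only pole at [oo]. *)
exists z; split=> [|P nP]; last first.
  have [Py|Py] := leP 0 (P y).
    apply: ord_ge_sum => -[i j] _ /=; apply: ord_ge_constM.
    rewrite -[0]addr0; apply: ord_geM; last exact: Wy.
    have := @ord_geX _ _ _ P 0 y j; rewrite mul0rn; apply.
    by rewrite ord_ge_nz.
  have Px : 0 < P x by move: Py; rewrite ordV // oppr_lt0.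
  rewrite zE; apply: ord_geD.
    by apply/ord_geN/ord_ge_sum => k _; apply/ord_ge_constM/PuN.
  rewrite -[0]addr0; apply: ord_geM; last exact: rR.
  by rewrite ord_ge_nz // ltW.
(* If [q != 0], the powers of [u] give [z] a pole at [oo]; otherwise [z] lies in
   [x R] and vanishes at [oo]. *)
pose q := \poly_(k < kap) d (inr (inord k)).
have tE : t = u * evp u q.
  rewrite (evp_wide iota u (size_poly _ _)) mulr_sumr; apply: eq_bigr => k _.
  by rewrite coef_poly ltn_ord inord_val mulrCA exprS.
have [q0|q0] := eqVneq q 0; last first.
  have [eq0 eqE] := ord_horner_pole u0 oou q0.
  have t0 : t != 0 by rewrite tE mulf_neq0.
  have oot : oo t < 0.
    rewrite tE ordM // eqE -mulrS; move: (size q).-1 => l.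
    by rewrite mulrn_wlt0.
  have nt0 : - t != 0 by rewrite oppr_eq0.
  have oont : oo (- t) = oo t.
    rewrite -mulN1r -(rmorph1 iota) -rmorphN ordM ?ord_const ?add0r //;
    by rewrite ?fmorph_eq0 oppr_eq0 oner_eq0.
  have [|z0 ooz] := @ordD_lt _ _ _ oo (- t) (x * r) nt0.
    apply: ord_ge_le xr1; rewrite oont; move: oot; move: (oo t) => l; lia.
  rewrite zE; apply: (@ord_neq0_transcendental _ _ _ oo) => //.
  by rewrite ooz oont lt_eqF.
have t0 : t = 0 by rewrite tE q0 evp0 mulr0.
have z1 : ord_ge oo 1 z by rewrite zE t0 oppr0 add0r.
(* If [z = 0], independence of the [W i] kills the remaining coefficients, but [d i0] is nonzero. *)
have z0 : z != 0.
  apply/eqP => z0; case/eqP: d0.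
  have dr k : d (inr k) = 0.
    have := congr1 (fun p : {poly F} => p`_k) q0.
    by rewrite coef_poly ltn_ord inord_val coef0.
  pose p i := \poly_(j < s.+1) d (inl (i, inord j)).
  have p0 : forall i, p i = 0.
    apply: WI; apply: etrans z0; rewrite /z.
    transitivity (\sum_i \sum_(j < s.+1) iota (d (inl (i, j))) * (y ^+ j * W i)).
      apply: eq_bigr => i _; rewrite (evp_wide iota y (size_poly _ _)) mulr_suml.
      by apply: eq_bigr => j _; rewrite coef_poly ltn_ord inord_val -mulrA.
    by rewrite pair_bigA; apply: eq_bigr => -[].
  case: i0 => [[i j]|k]; last exact: dr.
  have := congr1 (fun p : {poly F} => p`_j) (p0 i).
  by rewrite coef_poly ltn_ord inord_val coef0.
apply: (@ord_neq0_transcendental _ _ _ oo) => //.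
by move: z1; rewrite ord_ge_nz //; apply: contraTneq => ->.
Qed.

End RegularFunctions.

(** * Localized difference modules *)

Definition lin_indep (T : pzRingType) (M : lmodType T) k (w : 'I_k -> M) : Prop :=
  forall c : 'I_k -> T, \sum_i c i *: w i = 0 -> forall i, c i = 0.

Section BasisUpToTorsion.
Variables (T : idomainType) (M : lmodType T) (n : nat) (e : 'I_n -> M).
Hypothesis e_indep : lin_indep e.
Hypothesis e_max : forall w : 'I_n.+1 -> M, ~ lin_indep w.

(** Maximality makes [m] and [e] dependent, and the coefficient of [m] is nonzero because [e] is
    independent. *)
Lemma max_indep_torsion m :
  exists t : T, exists2 c : 'I_n -> T, t != 0 & t *: m = \sum_i c i *: e i.
Proof.
have /existsNP[c /not_implyP[]] := @e_max (ocons m e).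
rewrite big_ord_recl ocons0 => c0 cn0.
have [t0|t0] := eqVneq (c ord0) 0.
  case: cn0 => i; case: (unliftP ord0 i) => [j ->|-> //].
  apply: (e_indep (c := fun j => c (lift ord0 j))).
  by rewrite -[RHS]c0 t0 scale0r add0r; apply: eq_bigr => k _; rewrite oconsS.
exists (c ord0), (fun j => - c (lift ord0 j)) => //.
apply/eqP; rewrite -subr_eq0 -sumrN -[X in _ == X]c0; apply/eqP; congr (_ + _).
by apply: eq_bigr => k _; rewrite oconsS scaleNr opprK.
Qed.

Let fr : {rmorphism T -> {fraction T}} := @tofrac T.

Let den m := sval (cid (max_indep_torsion m)).
Let numP m := cid2 (svalP (cid (max_indep_torsion m))).
Let num m := s2val (numP m).
Let den0 m : den m != 0. Proof. exact: (s2valP (numP m)). Qed.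
Let numE m : den m *: m = \sum_i num m i *: e i.
Proof. exact: (s2valP' (numP m)). Qed.

(** The coordinate of [m] over the fraction field, computed with one chosen denominator; by
    [generic_coordP] any other multiple in the span gives the same value. *)
Definition generic_coord (i : 'I_n) (m : M) : {fraction T} :=
  tofrac (num m i) / tofrac (den m).

Let fden0 m : fr (den m) != 0.
Proof. by rewrite tofrac_eq0. Qed.

Lemma generic_coordP t m c i :
  t *: m = \sum_j c j *: e j -> tofrac t * generic_coord i m = tofrac (c i).
Proof.
move=> tm.
have h : t * num m i = den m * c i.
  apply/eqP; rewrite -subr_eq0; apply/eqP.
  apply: (e_indep (c := fun j => t * num m j - den m * c j)).
  transitivity (t *: (den m *: m) - den m *: (t *: m)); last first.
    by rewrite !scalerA [t * _]mulrC subrr.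
  rewrite numE tm !scaler_sumr -sumrB; apply: eq_bigr => j _.
  by rewrite scalerBl !scalerA.
rewrite /generic_coord mulrA -[tofrac t * _](rmorphM fr) h rmorphM /=.
by rewrite mulrAC mulfV ?mul1r //; exact: fden0.
Qed.

Lemma generic_coordD i : {morph generic_coord i : m m' / m + m'}.
Proof.
move=> m m'.
have h0 : tofrac (den m * den m') != 0 :> {fraction T}.
  by rewrite tofrac_eq0 mulf_neq0.
apply: (mulfI h0); rewrite mulrDr.
rewrite (@generic_coordP _ _ (fun j => den m' * num m j + den m * num m' j)).
  rewrite [RHS](_ : _ = fr (den m' * num m i) + fr (den m * num m' i)).
    by rewrite -rmorphD.
  congr (_ + _).
    apply: (@generic_coordP _ _ (fun j => den m' * num m j)).
    rewrite mulrC -scalerA numE scaler_sumr.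
    by apply: eq_bigr => j _; rewrite scalerA.
  apply: (@generic_coordP _ _ (fun j => den m * num m' j)).
  rewrite -scalerA numE scaler_sumr.
  by apply: eq_bigr => j _; rewrite scalerA.
rewrite scalerDr {1}[den m * _]mulrC -!scalerA !numE !scaler_sumr -big_split.
by apply: eq_bigr => j _; rewrite /= !scalerA scalerDl.
Qed.

Lemma generic_coordZ i t m :
  generic_coord i (t *: m) = tofrac t * generic_coord i m.
Proof.
apply: (mulfI (fden0 m)).
transitivity (tofrac t * (tofrac (den m) * generic_coord i m)); last exact: mulrCA.
rewrite (generic_coordP i (numE m)).
rewrite (@generic_coordP _ _ (fun j => t * num m j)); first exact: (rmorphM fr).
rewrite scalerA mulrC -scalerA numE scaler_sumr.
by apply: eq_bigr => j _; rewrite scalerA.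
Qed.

Lemma generic_coord_basis i j : generic_coord i (e j) = (i == j)%:R.
Proof.
have h : 1 *: e j = \sum_k (k == j)%:R *: e k.
  rewrite scale1r (bigD1 j) //= eqxx scale1r big1 ?addr0 // => k /negPf->.
  by rewrite scale0r.
rewrite -[LHS]mul1r -[1](rmorph1 fr) (generic_coordP i h).
exact: (rmorph_nat fr).
Qed.

Lemma generic_fin_generated : fin_generated (baseChange fr M).
Proof.
exists n, (fun i => bpure fr 1 (e i)).
have scE b m : bpure fr b m = b *: bpure fr 1 m by rewrite bpureZ mulr1.
have prZ t m : bpure fr 1 (t *: m) = fr t *: bpure fr 1 m.
  rewrite -scE /bpure -(pureZ t); congr pure.
  by rewrite restrE /GRing.scale /= mulr1.
apply: tens_ind => [|b m|v v' [c ->] [c' ->]].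
- by exists (fun=> 0); rewrite big1 // => i _; rewrite scale0r.
- exists (fun i => b / fr (den m) * fr (num m i)).
  rewrite -/(bpure fr b m) scE -{1}[b](mulfVK (fden0 m)) -scalerA -prZ numE.
  rewrite (big_morph (bpure fr 1) (pureDr _) (pure0r _ _)) scaler_sumr.
  by apply: eq_bigr => i _; rewrite prZ scalerA.
- exists (fun i => c i + c' i); rewrite -big_split; apply: eq_bigr => i _.
  by rewrite /= scalerDl.
Qed.

End BasisUpToTorsion.

(** * Semilinear maps on a base change *)

Section BaseChangeSemilinear.
Variables (R B : comPzRingType) (f : {rmorphism R -> B}) (M : lmodType R).
Variables (tau : {rmorphism R -> R}) (tauB : {rmorphism B -> B}) (s : M -> M).
Hypothesis s_semi : semilinear_endo tau s.
Hypothesis tauB_f : forall r, tauB (f r) = f (tau r).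

Lemma bpure_scale r b (m : M) : bpure f b (r *: m) = bpure f (f r * b) m.
Proof. by rewrite /bpure -(pureZ r). Qed.

Let b (r : restr f B^o) (m : M) : baseChange f M := bpure f (tauB r) (s m).

Let b_bal : balanced b.
Proof.
have [sD sZ] := s_semi.
split=> [r r' m|r m m'|t r m]; rewrite /b.
- by rewrite /bpure -pureDl; congr pure; apply: (rmorphD tauB).
- by rewrite sD /bpure -pureDr.
- by rewrite sZ bpure_scale -tauB_f; congr bpure; apply: (rmorphM tauB).
Qed.

Lemma base_change_semilinear :
  exists sigma : baseChange f M -> baseChange f M,
    semilinear_endo tauB sigma /\
    forall r m, sigma (bpure f r m) = bpure f (tauB r) (s m).
Proof.
exists (tens_lift b); split; last by move=> r m; rewrite (tens_lift_pure _ _ b_bal).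
have bD := tens_liftD b_bal; split=> [//|t].
apply: tens_additive_ext => [x y|x y|r m].
- transitivity (tens_lift b (t *: (x : baseChange f M) + t *: (y : baseChange f M))).
    by congr (tens_lift b _); exact: (@scalerDr _ (baseChange f M)).
  exact: bD.
- transitivity (tauB t *: (tens_lift b x + tens_lift b y : baseChange f M)).
    by congr (_ *: _); exact: bD.
  exact: (@scalerDr _ (baseChange f M)).
- transitivity (tens_lift b (bpure f (t * r) m)).
    by congr (tens_lift b _); exact: bpureZ.
  rewrite !(tens_lift_pure _ _ b_bal) /b bpureZ.
  by congr bpure; exact: (rmorphM tauB).
Qed.

End BaseChangeSemilinear.

(** * Localization at the twists of [f] *)

Section LocalizedDifferenceModule.
Variables (T : idomainType) (tau : {rmorphism T -> T}) (M : lmodType T).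
Variable (s : M -> M).
Hypothesis s_semi : semilinear_endo tau s.
Variable f : T.
Local Notation tw := (twists tau f).
Local Notation lc := (toloc tw : {rmorphism T -> loc tw}).
Local Notation ltau := (loc_map (@twists_stable T tau f)).

Lemma loc_difference : exists sigma : baseChange lc M -> baseChange lc M,
  semilinear_endo ltau sigma /\
  forall r m, sigma (bpure lc r m) = bpure lc (ltau r) (s m).
Proof.
apply: base_change_semilinear s_semi _ => t.
by rewrite /= loc_mapE; apply: locfrac_eq1; rewrite /= rmorph1.
Qed.

Hypotheses (f0 : f != 0) (tau_inj : injective tau).
Variables (n : nat) (e : 'I_n -> M).
Hypothesis e_indep : lin_indep e.
Hypothesis e_max : forall w : 'I_n.+1 -> M, ~ lin_indep w.

Lemma twists_neq0 x : x \in tw -> x != 0.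
Proof.
move=> /asboolP[ks ->]; apply: (big_ind (fun z => z != 0)) => [|y z y0 z0|k _].
- exact: oner_neq0.
- exact: mulf_neq0.
by elim: k => //= k IH; rewrite -(rmorph0 tau) (inj_eq tau_inj).
Qed.

(** This is the canonical embedding. It is well defined and injective because no twist of [f]
    vanishes, [tau] being injective and [T] a domain. *)
Definition loc_to_fraction (x : loc tw) : {fraction T} :=
  tofrac (repr x).1 / tofrac (val (repr x).2).

Let fr : {rmorphism T -> {fraction T}} := @tofrac T.

Let twf0 (u : {u : T | u \in tw}) : fr (val u) != 0.
Proof. by rewrite tofrac_eq0 twists_neq0 ?(valP u). Qed.

Lemma loc_to_fractionE t (u : {u : T | u \in tw}) :
  loc_to_fraction (locfrac t u) = fr t / fr (val u).
Proof.
have /locfrac_eq[v vS h] :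
    locfrac (repr (locfrac t u)).1 (repr (locfrac t u)).2 = locfrac t u.
  by rewrite /locfrac -surjective_pairing reprK.
move: h; rewrite /loc_to_fraction; case: (repr _) => a w /= h; apply/eqP.
rewrite [_ == _](eqr_div (fr a) (fr t) (twf0 w) (twf0 u)).
by rewrite -!rmorphM; apply/eqP; congr (fr _); apply: mulfI h; exact: twists_neq0.
Qed.

Lemma loc_to_fractionD : {morph loc_to_fraction : x y / x + y}.
Proof.
move=> x y; have [a [p ->]] := locfracP x; have [c [q ->]] := locfracP y.
rewrite locfracD !loc_to_fractionE addf_div ?twf0 //.
by rewrite /= rmorphD !rmorphM.
Qed.

Lemma loc_to_fractionM t x : loc_to_fraction (lc t * x) = fr t * loc_to_fraction x.
Proof.
have [a [p ->]] := locfracP x.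
by rewrite /= /toloc locfracM !loc_to_fractionE /= mul1r rmorphM mulrA.
Qed.

Lemma loc_to_fraction_eq0 x : loc_to_fraction x = 0 -> x = 0.
Proof.
have [a [p ->]] := locfracP x; rewrite loc_to_fractionE => /eqP.
rewrite mulf_eq0 invr_eq0 (negPf (twf0 p)) orbF tofrac_eq0 => /eqP->.
by rewrite -[RHS]/(locfrac 0 (den1 tw)); apply: locfrac_eq1; rewrite !mul0r.
Qed.

Let bf i (r : restr lc (loc tw)^o) (m : M) : {fraction T} :=
  loc_to_fraction r * generic_coord e_indep e_max i m.

Let bf_bal i : balanced (bf i).
Proof.
split=> [r r' m|r m m'|t r m]; rewrite /bf.
- by rewrite loc_to_fractionD mulrDl.
- by rewrite generic_coordD mulrDr.
- rewrite generic_coordZ restrE [in LHS]/GRing.scale /= loc_to_fractionM.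
  by rewrite [RHS]mulrCA [RHS]mulrA.
Qed.

(** The maps [bf i] are balanced and induce functionals dual to [e] with values in the fraction
    field, where [loc_to_fraction] loses nothing. *)
Lemma loc_basis_indep : lin_indep (fun i => bpure lc 1 (e i)).
Proof.
move=> c ce i; apply: loc_to_fraction_eq0.
have := congr1 (tens_lift (bf i)) ce.
rewrite (tens_lift0 (bf_bal i)) => <-.
rewrite (big_morph _ (tens_liftD (bf_bal i)) (tens_lift0 (bf_bal i))).
rewrite (bigD1 i) //= big1 => [|j ji].
  rewrite bpureZ (tens_lift_pure _ _ (bf_bal i)) /bf generic_coord_basis eqxx.
  by rewrite mulr1 addr0 mulr1.
rewrite bpureZ (tens_lift_pure _ _ (bf_bal i)) /bf generic_coord_basis.
by rewrite eq_sym (negPf ji) mulr0.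
Qed.

Definition loc_span (v : baseChange lc M) : Prop :=
  exists c : 'I_n -> loc tw, v = \sum_i c i *: bpure lc 1 (e i).

Lemma loc_spanD v v' : loc_span v -> loc_span v' -> loc_span (v + v').
Proof.
move=> [c ->] [c' ->]; exists (fun i => c i + c' i).
by rewrite -big_split; apply: eq_bigr => i _; rewrite /= scalerDl.
Qed.

Lemma loc_spanZ r v : loc_span v -> loc_span (r *: v).
Proof.
move=> [c ->]; exists (fun i => r * c i).
by rewrite scaler_sumr; apply: eq_bigr => i _; rewrite scalerA.
Qed.

Lemma loc_span0 : loc_span 0.
Proof. by exists (fun=> 0); rewrite big1 // => i _; rewrite scale0r. Qed.

(** The element [f] is itself a twist, so it is invertible in the localization. *)
Lemma loc_span_bpure m (c : 'I_n -> T) :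
  f *: m = \sum_i c i *: e i -> loc_span (bpure lc 1 m).
Proof.
move=> fm; have ftw : f \in tw.
  by apply/asboolP; exists [:: 0%N]; rewrite big_seq1.
pose g : loc tw := locfrac 1 (exist _ f ftw).
have -> : bpure lc 1 m = g *: bpure lc 1 (f *: m).
  rewrite bpure_scale bpureZ; congr bpure; rewrite /= mulr1.
  rewrite /g /toloc locfracM -[LHS]/(locfrac 1 (den1 tw)).
  by apply: locfrac_eq1; rewrite /= !mulr1.
apply: loc_spanZ; exists (fun i => lc (c i)).
rewrite fm (big_morph (bpure lc 1) (pureDr _) (pure0r _ _)).
by apply: eq_bigr => i _; rewrite bpure_scale bpureZ.
Qed.

(** The extension [sg] of [s] is semilinear and sends each basis vector into the span, since [f]
    clears the denominators of the [s (e i)]. *)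
Lemma loc_span_difference (m : M) :
  (forall i, exists c : 'I_n -> T, f *: s (e i) = \sum_j c j *: e j) ->
  loc_span (bpure lc 1 m) -> loc_span (bpure lc 1 (s m)).
Proof.
move=> fs [c mE]; have [sg [[sgD sgZ] sgp]] := loc_difference.
have -> : bpure lc 1 (s m) = sg (bpure lc 1 m).
  by rewrite sgp; congr bpure; rewrite (rmorph1 ltau).
have sg0 : sg 0 = 0 by apply: (addIr (sg 0)); rewrite -sgD !add0r.
rewrite mE (big_morph sg sgD sg0); apply: big_ind => [||i _].
- exact: loc_span0.
- exact: loc_spanD.
rewrite sgZ sgp; apply: loc_spanZ.
have -> : bpure lc (ltau 1) (s (e i)) = bpure lc 1 (s (e i)).
  by congr bpure; rewrite (rmorph1 ltau).
by have [c'] := fs i; apply: loc_span_bpure.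
Qed.

End LocalizedDifferenceModule.

(** The hypothesis on [Q] is an induction principle saying that [X] generates [M] under [T] and [s].
    It is applied to the elements whose image lies in the span of [e]. *)
Theorem localized_difference_free (T : idomainType) (tau : {rmorphism T -> T})
    (M : lmodType T) (s : M -> M) (B d : nat) (X : 'I_d -> M) :
  injective tau -> semilinear_endo tau s ->
  (forall k (w : 'I_k -> M), lin_indep w -> (k <= B)%N) ->
  (forall Q : M -> Prop, Q 0 -> (forall x y, Q x -> Q y -> Q (x + y)) ->
     (forall t x, Q x -> Q (t *: x)) -> (forall x, Q x -> Q (s x)) ->
     (forall i, Q (X i)) -> forall m, Q m) ->
  fin_generated (baseChange (@tofrac T : {rmorphism T -> {fraction T}}) M) /\
  exists2 f : T, f != 0 &
    let lc : {rmorphism T -> loc (twists tau f)} := toloc (twists tau f) in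
    fin_generated (baseChange lc M) /\ is_free (baseChange lc M).
Proof.
move=> tau_inj s_semi MB Xgen.
have [|n [e [eI emax']]] := max_family (Q := fun k w => @lin_indep T M k w) _ MB.
  by exists (fun=> 0) => c _ [].
have emax (w : 'I_n.+1 -> M) : ~ lin_indep w by move=> /emax'; rewrite ltnn.
split; first exact: generic_fin_generated eI emax.
have tors m : exists t : T, t != 0 /\ exists c : 'I_n -> T, t *: m = \sum_i c i *: e i.
  by have [t [c t0 h]] := max_indep_torsion eI emax m; exists t; split=> //; exists c.
pose den m := sval (cid (tors m)).
have [den0 denE] : (forall m, den m != 0) /\
    (forall m, exists c : 'I_n -> T, den m *: m = \sum_i c i *: e i).
  by split=> m; have [] := svalP (cid (tors m)).
pose f := (\prod_i den (X i)) * \prod_i den (s (e i)).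
exists f; first by rewrite mulf_neq0 //; apply/prodf_neq0.
move=> lc.
have mult g m : (exists h, g = h * den m) ->
    exists c : 'I_n -> T, g *: m = \sum_i c i *: e i.
  move=> [h ->]; have [c ce] := denE m; exists (fun i => h * c i).
  by rewrite -scalerA ce scaler_sumr; apply: eq_bigr => i _; rewrite scalerA.
have fX i : exists c : 'I_n -> T, f *: X i = \sum_j c j *: e j.
  apply: mult; rewrite /f (bigD1 i) //=.
  by eexists; rewrite -mulrA mulrC.
have fs i : exists c : 'I_n -> T, f *: s (e i) = \sum_j c j *: e j.
  apply: mult; rewrite /f [X in _ * X](bigD1 i) //=.
  by eexists; rewrite [den _ * _]mulrC mulrA.
have span1 m : loc_span (tau := tau) (f := f) e (bpure lc 1 m).
  apply: (Xgen (fun m => loc_span (tau := tau) (f := f) e (bpure lc 1 m)))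
    => [|x y hx hy|t x hx|x hx|i].
  - by rewrite /bpure pure0r; apply: loc_span0.
  - by rewrite /bpure pureDr; apply: loc_spanD.
  - by rewrite bpure_scale -bpureZ; apply: loc_spanZ.
  - exact: loc_span_difference.
  - by have [c] := fX i; apply: loc_span_bpure.
have span v : loc_span (tau := tau) (f := f) e v.
  move: v; apply: tens_ind => [|b m|v v']; [exact: loc_span0| |exact: loc_spanD].
  rewrite -/(bpure lc b m) -[b]mulr1 -bpureZ; exact: loc_spanZ.
split; first by exists n, (fun i => bpure lc 1 (e i)).
exists 'I_n, (fun i => bpure lc 1 (e i)); split=> [v|S c uS Sc i iS].
  by have [c ->] := span v; exists (index_enum 'I_n), c.
have h := loc_basis_indep (f := f) _ tau_inj eI emax.
(* Coefficients outside [S] are set to 0 to get a relation over all indices. *)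
have := h _ (fun i => if i \in S then c i else 0) _ i; rewrite iS; apply.
  by rewrite mulf_neq0 //; apply/prodf_neq0.
rewrite -[RHS]Sc [RHS]big_uniq //= [RHS]big_mkcond; apply: eq_bigr => j _.
by case: ifP => //; rewrite scale0r.
Qed.

(** * The motive *)

(* As [t] is transcendental, [(1 + t)^k = 1 + t^k] is an identity of polynomials,
   which makes [k] a power of the characteristic. *)
Lemma additive_exponent (F : finFieldType) (L : fieldType)
    (g : {rmorphism F -> L}) (t : L) (k : nat) :
  ~ algebraicOver g t -> (0 < k)%N -> (1 + t) ^+ k = 1 + t ^+ k ->
  (forall c : F, g c ^+ k = g c) -> exists l, k = (#|F| ^ l)%N.
Proof.
move=> t_tr k0 kD kF; have [p [e [pp pF qE]]] := card_fin_field F.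
have e0 : (0 < e)%N by have := finNzRing_gt1 F; rewrite qE; case: (e).
have pL : p%:R = 0 :> L := rmorph_pchar0 g pF.
have [m pm kE] := pfactor_coprime pp k0; set a := logn p k in kE.
(* The power map with exponent [p ^ a] is additive and injective on [L], so it can be removed from
   the identity. *)
have tm : (1 + t) ^+ m = 1 + t ^+ m.
  apply/eqP; rewrite -subr_eq0.
  suff /eqP : ((1 + t) ^+ m - (1 + t ^+ m)) ^+ (p ^ a) = 0.
    by rewrite expf_eq0 => /andP[].
  apply: (addIr ((1 + t ^+ m) ^+ (p ^ a))).
  rewrite -(exprD_pow _ _ _ pp pL) subrK add0r -exprM -kE kD.
  by rewrite (exprD_pow _ _ _ pp pL) expr1n -exprM -kE.
have m1 : m = 1%N.
  case: m pm kE tm => [|[//|m]] pm kE tm; first by rewrite kE in k0.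
  (* [P] vanishes at [t], hence is zero. As the exponent is at least 2, the derivative at 0 is
     [m.+2], so [p] would divide it. *)
  pose P : {poly F} := (1 + 'X) ^+ m.+2 - (1 + 'X^(m.+2)).
  have P0 : P = 0.
    apply/eqP; apply: contrapT => /negP P0; apply: t_tr; exists P => //.
    apply/rootP; rewrite /P rmorphB !rmorphD rmorphXn rmorphD rmorph1 /=.
    by rewrite map_polyX map_polyXn !hornerE tm subrr.
  have := congr1 (fun Q : {poly F} => Q^`().[0]) P0.
  rewrite /P derivB !derivD deriv_exp derivXn derivD derivX derivC deriv0.
  rewrite hornerD hornerN !add0r !hornerMn !hornerE expr0n /= mul0rn subr0.
  rewrite expr1n => /eqP; rewrite -(dvdn_pcharf pF) => pdvd.
  by move: pm; rewrite prime_coprime // pdvd.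
have {}kE : k = (p ^ a)%N by rewrite {1}kE m1 mul1n.
(* After removal of the [q]-powers, every [c] in [F] is a root of [X^(p^r) - X]; if [r > 0] this has
   degree [p ^ r < q]. *)
have [h [r [aE re]]] : exists h r, a = (h * e + r)%N /\ (r < e)%N.
  by exists (a %/ e)%N, (a %% e)%N; rewrite -divn_eq ltn_pmod.
have kq : k = (#|F| ^ h * p ^ r)%N by rewrite kE aE expnD [(h * e)%N]mulnC expnM qE.
have cF (c : F) : c ^+ (p ^ r) = c.
  apply: (fmorph_inj g); rewrite -[RHS]kF kq exprM rmorphXn; congr (_ ^+ _).
  rewrite -rmorphXn; congr (g _).
  by elim: h {aE kq} => [|h IH]; rewrite ?expn0 ?expr1 // expnS exprM expf_card.
exists h; rewrite kq; suff -> : r = 0%N by rewrite muln1.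
apply/eqP; rewrite -leqn0 leqNgt; apply/negP => r0.
pose P : {poly F} := 'X^(p ^ r) - 'X.
have pr1 : (1 < p ^ r)%N by rewrite -(exp1n r) ltn_exp2r // prime_gt1.
have sP : size P = (p ^ r).+1.
  by rewrite /P size_polyDl size_polyXn // size_polyN size_polyX.
have P0 : P != 0 by rewrite -size_poly_eq0 sP.
have := @max_poly_roots F P (enum F) P0 _ (enum_uniq F).
rewrite -cardE sP qE ltnS leqNgt ltn_exp2l ?prime_gt1 // re => h'.
suff : false by []; apply: h'; apply/allP => c _.
by rewrite /root /P !hornerE cF subrr.
Qed.

(** * Shape and degree of additive polynomials *)

Section LinearPolynomials.
Variables (F : finFieldType) (L : fieldType) (g : {rmorphism F -> L}) (d : nat).
Implicit Types p : {mpoly L[d]}.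

Lemma mcoeff_scale_vars (c : 'I_d -> L) p m :
  (mmap (@mpolyC d L) (fun i => (c i)%:MP * 'X_i) p)@_m =
  p@_m * \prod_i c i ^+ m i.
Proof.
rewrite [in RHS](mpolyE p) !raddf_sum mulr_suml; apply: eq_bigr => m' _ /=.
have -> : mmap1 (fun i => (c i)%:MP * 'X_i) m' =
    (\prod_i c i ^+ m' i)%:MP * 'X_[m'] :> {mpoly L[d]}.
  rewrite mpolyXE_id rmorph_prod -big_split; apply: eq_bigr => i _ /=.
  by rewrite exprMn rmorphXn.
rewrite mulrA -mpolyCM mul_mpolyC !mcoeffZ mcoeffX.
by case: eqVneq => [->|_]; rewrite ?mulr0 ?mul0r // !mulr1.
Qed.

(** Additivity at the points [c i * X_i] and [e i * X_i], read off at the monomial [m], is the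
    identity [addm]. Zero vectors exclude [m = 0], complementary 0-1 vectors exclude two variables,
    and [1], [t] reduce to [additive_exponent]. *)
Lemma linear_mcoeff p m (t : L) : ~ algebraicOver g t ->
  p \in @linear_pred F L g d -> p@_m != 0 ->
  exists i l, m = (U_(i) *+ (#|F| ^ l))%MM.
Proof.
move=> t_tr /asboolP/(_ _ (@mpolyC d L))[pD pZ] pm.
have addm (c e : 'I_d -> L) :
    \prod_i (c i + e i) ^+ m i = \prod_i c i ^+ m i + \prod_i e i ^+ m i.
  apply: (mulfI pm); rewrite mulrDr -!mcoeff_scale_vars -mcoeffD -pD; congr _@__.
  apply: eq_bigr => m' _; congr (_ * _); apply: mmap1_eq => i.
  by rewrite mpolyCD mulrDl.
have [i mi] : exists i, m i != 0%N.
  apply: contrapT => /forallNP m0.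
  have p1 : \prod_i (0 : L) ^+ m i = 1.
    by rewrite big1 // => i _; have /negP := m0 i; rewrite negbK => /eqP->.
  have := addm (fun=> 0) (fun=> 0); rewrite addr0 p1 => /eqP.
  by rewrite -subr_eq0 opprD addrA subrr add0r oppr_eq0 oner_eq0.
have mj j : j != i -> m j = 0%N.
  move=> ji; apply/eqP; apply: contrapT => /negP mj0.
  have := addm (fun l => (l == i)%:R) (fun l => (l != i)%:R).
  rewrite big1 => [|l _]; last first.
    by case: eqVneq; rewrite ?addr0 ?add0r expr1n.
  rewrite (bigD1 j) //= (negPf ji) expr0n (negPf mj0) mul0r add0r.
  rewrite (bigD1 i) //= eqxx expr0n (negPf mi) mul0r => /eqP.
  by rewrite oner_eq0.
pose k := m i.
have mE : m = (U_(i) *+ k)%MM.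
  apply/mnmP => j; rewrite mulmnE mnm1E; case: (eqVneq i j) => [<-|ij].
    by rewrite mul1n.
  by rewrite mul0n mj // eq_sym.
have prodE (c : L) : \prod_j c ^+ m j = c ^+ k.
  by rewrite (bigD1 i) //= big1 ?mulr1 // => j ji; rewrite mj // expr0.
have k0 : (0 < k)%N by rewrite lt0n.
have [||l kE] := @additive_exponent F L g t k t_tr k0.
- by have := addm (fun=> 1) (fun=> t); rewrite !prodE expr1n.
- move=> c; apply: (mulfI pm); rewrite -prodE -mcoeff_scale_vars.
  have -> : p@_m * g c = ((g c)%:MP * p)@_m by rewrite mul_mpolyC mcoeffZ mulrC.
  rewrite (pZ c (fun i => 'X_i)) -[in RHS](comp_mpoly_id p); congr (_ * _)@__.
  apply: eq_bigr => m' _; congr (_ * _); apply: mmap1_eq => j.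
  by rewrite tnth_mktuple.
by exists i, l; rewrite mE kE.
Qed.

Definition deg_le (N : nat) p : Prop := forall m, p@_m != 0 -> (mdeg m <= N)%N.

Lemma deg_le_msize p : deg_le (msize p) p.
Proof.
by move=> m; rewrite -mcoeff_msupp => /msize_mdeg_lt; apply: ltnW.
Qed.

Lemma deg_le_leq N N' p : (N <= N')%N -> deg_le N p -> deg_le N' p.
Proof. by move=> NN h m /h /leq_trans; apply. Qed.

Lemma deg_leM a b p q : deg_le a p -> deg_le b q -> deg_le (a + b) (p * q).
Proof.
move=> hp hq m; rewrite mcoeffM; apply: contraNT; rewrite -ltnNge => lt.
apply/eqP; rewrite big1 // => -[[m1 h1] [m2 h2]] /= /eqP mE.
have [->|/hp l1] := eqVneq p@_m1 0; first by rewrite mul0r.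
have [->|/hq l2] := eqVneq q@_m2 0; first by rewrite mulr0.
by move: lt; rewrite mE mdegD ltnNge leq_add.
Qed.

Lemma deg_leX a p n : deg_le a p -> deg_le (a * n) (p ^+ n).
Proof.
move=> hp; elim: n => [|n IH]; last by rewrite exprS mulnS; apply: deg_leM.
by move=> m; rewrite expr0 mcoeff1; case: (eqVneq _ 0%MM) => [->|_]; rewrite ?mdeg0 ?eqxx.
Qed.

Lemma deg_le_comp a N p (u : d.-tuple {mpoly L[d]}) :
  (forall i, deg_le a (tnth u i)) -> deg_le N p -> deg_le (a * N) (p \mPo u).
Proof.
move=> hu hp; rewrite comp_mpolyE; elim/big_ind: _ => [m|x y hx hy m|m _].
- by rewrite mcoeff0 eqxx.
- rewrite mcoeffD; have [->|/hx //] := eqVneq x@_m 0.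
  by rewrite add0r; apply: hy.
- have [->|/hp mN] := eqVneq p@_m 0; first by rewrite scale0r => m'; rewrite mcoeff0 eqxx.
  have h : deg_le (a * mdeg m) (\prod_(i < d) tnth u i ^+ m i).
    rewrite mdegE big_distrr /=.
    elim/big_rec2: _ => [|i y x _ h]; last by apply: deg_leM => //; apply: deg_leX.
    by move=> m'; rewrite mcoeff1; case: (eqVneq _ 0%MM) => [->|_]; rewrite ?mdeg0 ?eqxx.
  move=> m'; rewrite mcoeffZ mulf_eq0 negb_or => /andP[_ /h].
  by move=> /leq_trans; apply; rewrite leq_mul2l mN orbT.
Qed.

Lemma linear_span p n (t : L) : ~ algebraicOver g t ->
  p \in @linear_pred F L g d -> deg_le (#|F| ^ n) p ->
  exists c : 'I_d * 'I_n.+1 -> L,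
    p = \sum_il c il *: 'X_[U_(il.1) *+ (#|F| ^ il.2)].
Proof.
move=> t_tr hp pn; pose u (il : 'I_d * 'I_n.+1) := (U_(il.1) *+ (#|F| ^ il.2))%MM.
have q1 : (1 < #|F|)%N := finNzRing_gt1 F.
have u_inj : injective u.
  move=> [i l] [j k] /mnmP uE; have := uE i; rewrite !mulmnE !mnm1E eqxx mul1n /=.
  case: eqVneq => [->|_]; last first.
    by rewrite mul0n => /eqP; rewrite -leqn0 leqNgt expn_gt0 (ltnW q1).
  by rewrite mul1n => /eqP; rewrite eqn_exp2l // => /eqP/val_inj ->.
exists (fun il => p@_(u il)); apply/mpolyP => m; rewrite raddf_sum /=.
under eq_bigr => il _ do rewrite mcoeffZ mcoeffX -/(u il).
have [pm|pm] := eqVneq p@_m 0.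
  rewrite pm big1 // => il _; case: eqVneq => [->|_]; last by rewrite mulr0.
  by rewrite pm mul0r.
have [i [l mE]] := linear_mcoeff t_tr hp pm.
have ln : (l < n.+1)%N.
  by have := pn m pm; rewrite mE mdegMn mdeg1 mul1n leq_exp2l.
rewrite (bigD1 (i, Ordinal ln)) //= -[u _]/(U_(i) *+ (#|F| ^ l))%MM -mE eqxx mulr1.
rewrite big1 ?addr0 // => il ne; case: eqVneq => [uE|]; last by rewrite mulr0.
by case/eqP: ne; apply: u_inj; rewrite uE mE.
Qed.

End LinearPolynomials.

Lemma tens_indep_left (F : fieldType) (M N : lmodType F) k (m : 'I_k -> M)
    (n : 'I_k -> N) :
  indep m -> \sum_i pure (m i) (n i) = 0 -> forall i, n i = 0.
Proof.
move=> mI s0; pose b (x : M) (y : N) := pure y x.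
have bb : balanced b by split=> *; rewrite /b ?pureDl ?pureDr ?pureZ.
apply: (tens_indep (n := m)) => //.
have := congr1 (tens_lift b) s0.
rewrite (tens_lift0 bb) (big_morph _ (tens_liftD bb) (tens_lift0 bb)).
move=> h; apply: etrans h.
by apply: eq_bigr => i _; rewrite (tens_lift_pure _ _ bb).
Qed.

Section CoordinateTensor.
Variables (F : finFieldType) (C : curve F) (oo : closed_point C).
Variables (L : fieldType) (ell : {rmorphism ffield C -> L}).
Local Notation T := (tensAL oo ell).

Lemma exists_transcendental_coordRing :
  exists a : coordRing oo, ~ algebraicOver (fconst C) (cval a).
Proof.
have [z [ztr zreg]] := exists_transcendental_regular (ffieldP C) oo.
have zin : z \in regular_off oo.
  by apply/asboolP => P nP z0; rewrite -ord_ge_nz //; apply: zreg.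
by exists (CoordRing zin).
Qed.

Lemma ell_transcendental (z : ffield C) :
  ~ algebraicOver (fconst C) z -> ~ algebraicOver (Lconst ell) (ell z).
Proof.
move=> ztr [p p0 pz]; apply: ztr; exists p => //.
by move: pz; rewrite /Lconst map_poly_comp /= fmorph_root.
Qed.

Let A_frob_base c : frob (coord_const oo) (coord_const oo c) = coord_const oo c.
Proof. exact: frob_base. Qed.
Let L_id c : @idfun L (Lconst ell c) = Lconst ell c.
Proof. by []. Qed.

(* Frobenius on the factor [A] composed with [tau] is the [q]-power map of the
   domain [A (x) L]. *)
Lemma tauAL_inj : injective (@tauAL F C oo L ell).
Proof.
pose h := algTens_map (f := coord_const oo) (g := Lconst ell)
  (coord_const oo) (Lconst ell) (frob (coord_const oo)) idfun.
have hD : {morph h : x y / x + y} := algTens_mapD A_frob_base L_id.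
have h0 : h 0 = 0 := algTens_map0 A_frob_base L_id.
have natT n : n%:R = tensor ell n%:R 1 :> T.
  elim: n => [|n IH]; first by rewrite /tensor /apure pure0l.
  by rewrite -!natr1 IH /tensor apureDl.
have T0 p : p \in [pchar F] -> p%:R = 0 :> T.
  by move=> pF; rewrite natT (rmorph_pchar0 (coord_const oo) pF) /tensor /apure pure0l.
have hq x : h (tauAL x) = x ^+ #|F|.
  apply: (algTens_ext (u := fun x => h (tauAL x)) (v := fun x => x ^+ #|F|))
    => [y z|y z|a l] /=.
  - by rewrite rmorphD hD.
  - by have := exprD_card 1 y z T0; rewrite expn1.
  - rewrite -/(tensor ell a l) tauAL_tensor apureX.
    exact: (algTens_map_pure A_frob_base L_id).
move=> x y xy; apply/eqP; rewrite -subr_eq0.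
have : (x - y) ^+ #|F| = 0.
  by rewrite -hq (_ : tauAL (x - y) = 0) // rmorphB /= xy subrr.
by move=> /eqP; rewrite expf_eq0 => /andP[].
Qed.

(** The powers of a transcendental [a] are independent over [F], hence stay independent over [L]
    after tensoring. *)
Lemma tensor_powers_eq0 (a : coordRing oo) (p : {poly L}) :
  ~ algebraicOver (fconst C) (cval a) ->
  \sum_(j < size p) tensor ell (a ^+ j) p`_j = 0 -> p = 0.
Proof.
move=> a_tr s0; apply/polyP => j; rewrite coef0.
have [jp|jp] := ltnP j (size p); last exact: nth_default.
apply: (tens_indep_left (m := fun j : 'I_(size p) =>
    (a ^+ j : restr (coord_const oo) (coordRing oo)^o)) _ s0 (Ordinal jp)).
move=> c cs i; pose q := \poly_(j < size p) (if insub j is Some j' then c j' else 0).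
have q0 : q = 0.
  apply/eqP; apply: contrapT => /negP q0; apply: a_tr; exists q => //.
  apply/rootP; rewrite (@horner_coef_wide _ (size p)) ?size_map_poly ?size_poly //.
  have := congr1 (fun x : coordRing oo => cval x) cs.
  pose v : {rmorphism coordRing oo -> ffield C} := val.
  rewrite (big_morph (@cval _ _ oo) (rmorphD v) (rmorph0 v)) => cs'.
  apply: etrans cs'; apply: eq_bigr => l _; rewrite coef_map coef_poly ltn_ord valK /=.
  symmetry; apply: (etrans (rmorphM v (coord_const oo (c l)) (a ^+ l))).
  by congr (_ * _); exact: (rmorphXn v).
have := congr1 (fun q : {poly F} => q`_i) q0.
by rewrite coef_poly ltn_ord valK coef0.
Qed.

Variable E : andersonModule oo ell.
Local Notation d := (adim E).
Local Notation phi := (aphi E).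
Local Notation g := (Lconst ell).

Lemma mpol_sum (I : finType) (m : I -> motive E) :
  mpol (\sum_i m i) = \sum_i mpol (m i).
Proof. exact: (big_morph (@mpol _ _ _ _ _ E) (fun x y => erefl) erefl). Qed.

Lemma motive_rank_bounded : exists B, forall k (w : 'I_k -> motive E),
  @lin_indep T (motive E) k w -> (k <= B)%N.
Proof.
have [a a_tr] := exists_transcendental_coordRing.
have t_tr := ell_transcendental a_tr.
have q1 : (1 < #|F|)%N := finNzRing_gt1 F.
have le_pow N : (N <= #|F| ^ N)%N by apply/ltnW/ltn_expl.
(* Degrees are measured by exponents of [q]; since [N <= q^N], the size itself serves as a crude
   exponent. *)
pose r := \max_i msize (tnth (phi a) i).
have phi_r i : deg_le (#|F| ^ r) (tnth (phi a) i).
  apply: deg_le_leq (@deg_le_msize _ _ _); apply: leq_trans (le_pow r).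
  exact: (leq_bigmax (F := fun i => msize (tnth (phi a) i))).
exists (d * r)%N => k w wI; rewrite leqNgt; apply/negP => kB.
pose n0 := \max_i msize (mpol (w i)).
have w_n i : deg_le (#|F| ^ n0) (mpol (w i)).
  apply: deg_le_leq (@deg_le_msize _ _ _); apply: leq_trans (le_pow n0).
  exact: (leq_bigmax (F := fun i => msize (mpol (w i)))).
pose v i j : {mpoly L[d]} := mpol (w i) \mPo phi (a ^+ j).
(* Each composition with [phi a] multiplies the degree by at most [q^r], so the exponent grows by
   [r]. *)
have v_n i j : deg_le (#|F| ^ (n0 + r * j)) (v i j).
  elim: j => [|j IH].
    by rewrite /v expr0 comp_aphi1 muln0 addn0.
  rewrite /v exprSr comp_aphiM mulnS addnCA expnD.
  exact: deg_le_comp phi_r IH.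
have [] := @growth_dependence L {mpoly L[d]} k (d * r) (d * n0.+1) v kB.
  move=> s; exists ('I_d * 'I_(n0 + r * s).+1)%type.
  exists (fun il : 'I_d * 'I_(n0 + r * s).+1 => 'X_[U_(il.1) *+ (#|F| ^ il.2)]).
  rewrite card_prod !card_ord; split=> [|i j js]; first by nia.
  apply: (linear_span (g := g)) t_tr _ _; first exact/linear_comp_aphi/motiveP.
  apply: deg_le_leq (v_n i j); rewrite leq_exp2l // leq_add2l leq_mul2l js.
  by rewrite orbT.
move=> p [[i pi] ps].
case/eqP: pi; apply: (tensor_powers_eq0 a_tr).
(* An [L]-relation among the [a^j w_i] is a relation among the [w_i] over the tensor product, whose
   coefficients must vanish. *)
apply: (wI (fun i => \sum_(j < size (p i)) tensor ell (a ^+ j) (p i)`_j)).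
apply: val_inj; rewrite /= mpol_sum; apply: etrans ps; apply: eq_bigr => l _.
rewrite scaler_suml mpol_sum; apply: eq_bigr => j _.
by rewrite motive_tensorE.
Qed.

(** By [linear_span] every [m] is an [L]-combination of the [X_i^(q^l)], which are iterated
    Frobenius images of the coordinates. *)
Lemma motive_difference_generated (Q : motive E -> Prop) :
  Q 0 -> (forall x y, Q x -> Q y -> Q (x + y)) ->
  (forall (t : T) x, Q x -> Q (t *: x)) -> (forall x, Q x -> Q (mfrob x)) ->
  (forall i, Q (MkMotive (linear_X g i))) -> forall m, Q m.
Proof.
move=> Q0 QD QZ QF QX m.
have [a a_tr] := exists_transcendental_coordRing.
have t_tr := ell_transcendental a_tr.
have q1 : (1 < #|F|)%N := finNzRing_gt1 F.
have mn : deg_le (#|F| ^ msize (mpol m)) (mpol m).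
  by apply: deg_le_leq (@deg_le_msize _ _ _); apply/ltnW/ltn_expl.
have [c mE] := linear_span t_tr (motiveP m) mn.
pose X i l : motive E := iter l (@mfrob _ _ _ _ _ E) (MkMotive (linear_X g i)).
have XE i l : mpol (X i l) = 'X_[U_(i) *+ (#|F| ^ l)].
  elim: l => [|l IH]; first by rewrite expn0.
  by rewrite /= IH -!mpolyXn -exprM expnSr.
have -> : m = \sum_il tensor ell 1 (c il) *: X il.1 il.2.
  apply: val_inj; rewrite /= mpol_sum [LHS]mE; apply: eq_bigr => il _.
  by rewrite motive_tensorE comp_aphi1 XE.
apply: (big_ind Q) => // il _; apply: QZ; rewrite /X.
by elim: (nat_of_ord il.2) => //= l; apply: QF.
Qed.

End CoordinateTensor.

Theorem theorem7p1 (F : finFieldType) (C : curve F) (oo : closed_point C)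
    (Coo : completedClosure oo) (L : fieldType)
    (ell : {rmorphism ffield C -> L}) (incl : {rmorphism L -> Cinf Coo})
    (inclE : forall x : ffield C, incl (ell x) = Cinf_in Coo (Kbar_in Coo x))
    (E : andersonModule oo ell) :
  [/\ fin_generated (genericMotive E),
      exists f : tensAL oo ell,
        [/\ f != 0, locMotive_difference E f & fin_generated (locMotive E f)]
    & exists f : tensAL oo ell,
        [/\ f != 0, locMotive_difference E f, fin_generated (locMotive E f)
          & is_free (locMotive E f)]].
Proof.
have semi : semilinear_endo (tau_morphism oo ell) (@mfrob _ _ _ _ _ E).
  by split; [exact: mfrobD|exact: mfrobZ].
have [B MB] := motive_rank_bounded E.
have [gen [f f0 [fg fr]]] := localized_difference_free
  (@tauAL_inj F C oo L ell) semi MB (@motive_difference_generated F C oo L ell E).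
have diff : locMotive_difference E f by exact: loc_difference semi f.
(* The same [f] serves for finite generation and for freeness. *)
by split=> //; exists f.
Qed.
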